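(* Let $p\in\mathbb{S}^2$ and let $$A=\frac{2}{1+\log\pi}+\frac{8}{\pi^2(1+\log 2)^2},\qquad B=\frac{2}{1+\log\pi}+\frac{8}{\pi^2(1+\log\pi)^2}.$$ Then $$\sup_{f\in H^1(\mathbb{S}^2)\setminus\{0\}}\frac{Q(f;\phi)}{T_A(f)}=1\qquad\text{and}\qquad \sup_{f\in H^1(\mathbb{S}^2)\setminus\{0\}}\frac{Q(f;\psi)}{T_B(f)}=1.$$
   Context: $\mathbb{S}^2\subset\mathbb{R}^3$ is the unit sphere with its surface measure $\sigma$ (in spherical coordinates $d\sigma=\sin\theta\,d\theta\,d\varphi$), $\nabla$ is the (weak) gradient on $\mathbb{S}^2$, and $d(x,p)\in[0,\pi]$ is the geodesic distance from $x$ to the fixed point $p$. $H^1(\mathbb{S}^2)$ is the real Sobolev space obtained as the completion of $C^\infty(\mathbb{S}^2)$ in the norm $\left(\|f\|_{L^2}^2+\|\nabla f\|_{L^2}^2\right)^{1/2}$; equivalently, the functions in $L^2(\mathbb{S}^2)$ whose weak gradient is in $L^2$. For $t\in(0,\pi]$ put $\phi(t)=\log(\pi e/t)$, and for $t\in(0,\pi)$ put $\psi(t)=\phi(\sin t)=\log(\pi e/\sin t)$. For $\chi\in\{\phi,\psi\}$ let $\rho_\chi(t)=t\,\chi(t)$ and $$Q(f;\chi)=\frac14\int_{\mathbb{S}^2}\left(\frac{f(x)^2}{\rho_\chi(d(x,p))^2}+\frac{f(x)^2}{\rho_\chi(\pi-d(x,p))^2}\right)d\sigma(x)$$ (the integrand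 is defined off the two points $p$ and $-p$, which have measure zero). For a constant $C>0$ let $$T_C(f)=\int_{\mathbb{S}^2}|\nabla f|^2\,d\sigma+\frac{C}{4}\int_{\mathbb{S}^2}f^2\,d\sigma.$$ *)

(* Defs.v *)
From HB Require Import structures.
From mathcomp Require Import all_boot all_order all_algebra.
From mathcomp Require Import all_classical all_reals all_analysis.
From mathcomp Require Import measurable_realfun.

Set Implicit Arguments.
Unset Strict Implicit.
Unset Printing Implicit Defensive.

Import Order.TTheory GRing.Theory Num.Theory.
Import numFieldNormedType.Exports.

Local Open Scope classical_set_scope.
Local Open Scope ring_scope.

(* R * R * R rather than 'rV[R]_3: products carry both a normed-module and a
   (Borel) measurable structure.  The norm of the product is the maximum norm,
   so Euclidean lengths are always written with [dot]. *)
Notation R3 R := (R * R * R)%type (only parsing).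

Section sphere.
Context {R : realType}.
Implicit Types (x y p : R3 R) (F f : R3 R -> R) (g : R3 R -> R3 R).

Definition dot x y : R := x.1.1 * y.1.1 + x.1.2 * y.1.2 + x.2 * y.2.

Definition sphere : set (R3 R) := [set x | dot x x = 1].

(* z = (theta, phi), colatitude and longitude. *)
Definition spherical (z : R * R) : R3 R :=
  (sin z.1 * cos z.2, sin z.1 * sin z.2, cos z.1).

Definition spherical_domain : set (R * R) :=
  `[0, pi]%classic `*` `[0, pi *+ 2]%classic.

(* The image under [spherical] of sin(theta) dtheta dphi; it is a measure on
   all of R^3, concentrated on [sphere]. *)
Definition surface_measure (X : set (R3 R)) : \bar R :=
  (\int[(@lebesgue_measure R \x @lebesgue_measure R)%E]_(z in
     spherical_domain `&` spherical @^-1` X) (sin z.1)%:E)%E.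

Lemma measurable_spherical : measurable_fun setT spherical.
Proof.
have m1 (h : R -> R) : continuous h -> measurable_fun setT (fun z : R * R => h z.1).
  move=> ch; apply: (measurableT_comp (f := h)) => //.
  exact: continuous_measurable_fun.
have m2 (h : R -> R) : continuous h -> measurable_fun setT (fun z : R * R => h z.2).
  move=> ch; apply: (measurableT_comp (f := h)) => //.
  exact: continuous_measurable_fun.
apply: measurable_fun_pair; last exact: (m1 _ (@continuous_cos R)).
apply: measurable_fun_pair; apply: measurable_funM.
- exact: (m1 _ (@continuous_sin R)).
- exact: (m2 _ (@continuous_cos R)).
- exact: (m1 _ (@continuous_sin R)).
- exact: (m2 _ (@continuous_sin R)).
Qed.

Lemma measurable_spherical_domain : measurable spherical_domain.
Proof. by apply: measurableX; exact: measurable_itv. Qed.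

Let measurable_pre (X : set (R3 R)) : measurable X ->
  measurable (spherical_domain `&` spherical @^-1` X).
Proof.
move=> mX; apply: measurableI; first exact: measurable_spherical_domain.
by rewrite -[X in measurable X]setTI; exact: measurable_spherical.
Qed.

Let surface_measure0 : surface_measure set0 = 0%E.
Proof. by rewrite /surface_measure preimage_set0 setI0 integral_set0. Qed.

Let density_ge0 (z : R * R) : spherical_domain z -> (0 <= (sin z.1)%:E)%E.
Proof.
move=> [/=]; rewrite in_itv /= => /andP[z0 zpi] _.
by rewrite lee_fin sin_ge0_pi// z0 zpi.
Qed.

Let surface_measure_ge0 X : (0 <= surface_measure X)%E.
Proof. by apply: integral_ge0 => z [/density_ge0]. Qed.

Let surface_measure_sigma_additive : semi_sigma_additive surface_measure.
Proof.
move=> X mX tX mUX; rewrite /surface_measure preimage_bigcup setI_bigcupr.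
rewrite ge0_integral_bigcup//=.
- apply: is_cvg_ereal_nneg_natsum_cond => n _ _.
  by apply: integral_ge0 => z [/density_ge0].
- by move=> n; exact: measurable_pre.
- apply/measurable_EFinP; apply: measurable_funTS.
  apply: (measurableT_comp (f := @sin R)) => //.
  by apply: continuous_measurable_fun; exact: continuous_sin.
- by move=> z [n _ [/density_ge0]].
- apply/trivIsetP => i j _ _ ij; rewrite setIACA setIid -preimage_setI.
  by move/trivIsetP : tX => ->//; rewrite preimage_set0 setI0.
Qed.

HB.instance Definition _ := isMeasure.Build _ _ _ surface_measure
  surface_measure0 surface_measure_ge0 surface_measure_sigma_additive.

(* Great-circle distance, for x and p on the sphere. *)
Definition geodesic x p : R := acos (dot x p).

Definition smooth F : Prop :=
  forall (vs : seq (R3 R)) x,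
    differentiable (foldr (fun v (h : R3 R -> R) y => 'D_v h y) F vs) x.

Definition gradient F x : R3 R :=
  ('D_((1, 0, 0) : R3 R) F x, 'D_((0, 1, 0) : R3 R) F x,
   'D_((0, 0, 1) : R3 R) F x).

(* Gradient on the sphere of the restriction of F: the tangential part of the
   Euclidean gradient.  At a point of the sphere it only depends on the
   values of F on the sphere. *)
Definition sphere_gradient F x : R3 R :=
  gradient F x - dot (gradient F x) x *: x.

Definition L2norm2 f : \bar R :=
  (\int[surface_measure]_(x in sphere) (f x ^+ 2)%:E)%E.

Definition L2norm2_field g : \bar R :=
  (\int[surface_measure]_(x in sphere) (dot (g x) (g x))%:E)%E.

(* C^oo(S^2) consists of the restrictions of the smooth functions on R^3, and
   f |-> (f, grad f) embeds it isometrically, for the H^1 norm, in the Hilbert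
   space L^2(S^2) x L^2(S^2; R^3).  The completion is the closure of the image:
   [H1 (f, g)] says that f is in H^1(S^2) with weak gradient g.  As usual
   functions are representatives, to be identified when equal a.e. *)
Definition H1 : set ((R3 R -> R) * (R3 R -> R3 R)) :=
  [set u | [/\ measurable_fun sphere u.1, (L2norm2 u.1 < +oo)%E,
    measurable_fun sphere u.2, (L2norm2_field u.2 < +oo)%E &
    exists F : nat -> R3 R -> R,
      [/\ forall n, smooth (F n),
        L2norm2 (fun x => F n x - u.1 x) @[n --> \oo] --> 0%E &
        L2norm2_field (fun x => sphere_gradient (F n) x - u.2 x)
          @[n --> \oo] --> 0%E]]].

Definition ae_zero f : Prop :=
  {ae surface_measure, forall x, sphere x -> f x = 0}.

Definition phi (t : R) : R := ln (pi * expR 1 / t).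

Definition psi (t : R) : R := phi (sin t).

Definition rho (chi : R -> R) (t : R) : R := t * chi t.

(* At the two points p and -p, where the integrand is undefined, it takes
   arbitrary values, which is harmless as these points are negligible. *)
Definition Q p f (chi : R -> R) : \bar R :=
  ((4^-1)%:E * \int[surface_measure]_(x in sphere)
    (f x ^+ 2 / rho chi (geodesic x p) ^+ 2 +
     f x ^+ 2 / rho chi (pi - geodesic x p) ^+ 2)%:E)%E.

Definition T (C : R) f g : \bar R :=
  (L2norm2_field g + (C / 4)%:E * L2norm2 f)%E.

Definition constA : R :=
  2 / (1 + ln pi) + 8 / (pi ^+ 2 * (1 + ln 2) ^+ 2).

Definition constB : R :=
  2 / (1 + ln pi) + 8 / (pi ^+ 2 * (1 + ln pi) ^+ 2).

End sphere.

(* Main.v *)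
From HB Require Import structures.
Require Import Defs.
From mathcomp Require Import all_boot all_order all_algebra.
From mathcomp Require Import all_classical all_reals all_analysis.
From mathcomp Require Import measurable_realfun ring lra.

Set Implicit Arguments.
Unset Strict Implicit.
Unset Printing Implicit Defensive.

Import Order.TTheory GRing.Theory Num.Theory.
Import numFieldNormedType.Exports.

Local Open Scope classical_set_scope.
Local Open Scope ring_scope.

(**
Write c = x.p, so that the distance d from x to p satisfies c = cos d.

Both suprema are at most 1 because of a Hardy inequality proved by the
ground-state method.  If u > 0 depends only on c and Y = u'/u, then expanding
0 <= |grad f - f Y(c) grad c|^2 and integrating the cross term by parts gives
  int |grad f|^2 >= int f^2 (2 c Y - (1 - c^2) (Y' + Y^2)),
so T_C f bounds int f^2 N as soon as
  (1 - c^2) (Y' + Y^2) - 2 c Y + N <= C / 4      on (-1, 1).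
This is the notion of ground_state.  It remains to find u for which N dominates
the weight of Q pointwise.  With l(s) = k - ln s:
- for phi, u = sqrt (l(1 - c) l(1 + c)) and k = 2 (1 + ln pi) - ln 2.  Then
  phi(sqrt (2 s)) = l(s) / 2, and N is the sum of 1 / (2 s l(s)^2) over
  s = 1 - c and s = 1 + c.  As 2 (1 - cos d) <= d^2 and rho_phi is increasing,
  N dominates the weight of Q.  The Riccati expression is then computed exactly
  (pole_riccati) and is at most 3/10 <= A / 4;
- for psi, u = sqrt (l(1 - c^2)) exp (- 7 c^2 / 1000) and k = 2 (1 + ln pi), for
  which psi(d) = l(1 - c^2) / 2 exactly.  The exponential factor is a small
  correction; without it the inequality fails at the equator.
Since Y is singular at the poles, t Y(t c) with t < 1 is used instead of Y; it
satisfies the same inequality with N(t c), first for smooth f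
(ground_state_smooth), then on H^1 by density (ground_state_H1), and Fatou's
lemma lets t tend to 1 (hardy_H1).

The suprema are at least 1 because the singular part of the Hardy inequality is
critical at p.  For phi as well as for psi, take k = 2 (1 + ln pi) and let
f_e = sqrt (k - ln (1 - c + e)) with e -> 0.  Its mass stays bounded
(radial_test_log_le).  With s = 1 - c,
|grad f_e|^2 <= D := s / (2 (s + e)^2 l(s + e)), and near p the Hardy density
f_e^2 / (4 rho^2) is at least D up to a bounded error (test_energy_le_weight).
The integral of D behaves like that of 1 / (s l(s)) over s > e and tends to
infinity (radial_test_energy_ge).  Hence Q >= int D - O(1) and
T <= int D + O(1), and the quotient tends to 1.

Both halves rest on one identity, the divergence theorem for a function times
the tangential field h(c) (p - c x) (divergence_radial), which is proved in
spherical coordinates.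
*)

(** * Borel measurability *)

Definition base_of (T : topologicalType) (I : Type) (B : I -> set T) :=
  forall x (U : set T), nbhs x U -> exists i, B i x /\ B i `<=` U.

Lemma base_of_prod (T1 T2 : topologicalType) (I1 I2 : Type)
    (B1 : I1 -> set T1) (B2 : I2 -> set T2) :
  base_of B1 -> base_of B2 ->
  base_of (fun i : I1 * I2 => (B1 i.1 `*` B2 i.2 : set (T1 * T2))).
Proof.
move=> b1 b2 [x1 x2] U [[U1 U2] /= [/b1[i [xi iU]] /b2[j [xj jU]]] UU].
by exists (i, j); split => // -[y1 y2] [/= /iU ? /jU ?]; exact: UU.
Qed.

Definition rat_itv (R : realType) (q : rat * rat) : set R :=
  `]ratr q.1, ratr q.2[%classic.

Lemma base_of_rat_itv (R : realType) : base_of (@rat_itv R).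
Proof.
move=> x U /nbhs_ballP[e /= e0 eU].
have /rat_in_itvoo[q1] : x - e < x by rewrite ltrBlDr ltrDl.
rewrite in_itv/= => /andP[eq1 q1x].
have /rat_in_itvoo[q2] : x < x + e by rewrite ltrDl.
rewrite in_itv/= => /andP[xq2 q2e].
exists (q1, q2); split; first by rewrite /rat_itv/= in_itv/= q1x.
move=> y; rewrite /rat_itv/= in_itv/= => /andP[q1y yq2]; apply: eU.
by rewrite ball_itv/= in_itv/= (lt_trans eq1)//= (lt_trans yq2).
Qed.

Section continuous_measurable.
Context {R : realType}.

(** The product sigma-algebra is generated by boxes.  The preimage of an open set
    under a continuous function is a countable union of boxes with rational end
    points, which is where countability of the index type of B enters. *)
Lemma open_base_measurable (T : topologicalType) d (M : measurableType d)
    (I : countType) (B : I -> set T) (g : M -> T) :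
  base_of B -> (forall i, measurable (g @^-1` B i)) ->
  forall f : T -> R, continuous f -> measurable_fun setT (f \o g).
Proof.
move=> bB mB f cf; apply: (measurability _ (RGenOpens.measurableE R)).
move=> _ [_ [a [b ->] <-]]; rewrite setTI comp_preimage.
set O := f @^-1` _.
have oO : open O by move/continuousP : cf; apply; exact: interval_open.
have -> : g @^-1` O = \bigcup_i (if `[< B i `<=` O >] then g @^-1` B i else set0).
  apply/seteqP; split=> [x Ox|x [i _]]; last by case: ifPn => // /asboolP BO /BO.
  have [i [Bi iO]] := bB _ _ (open_nbhs_nbhs (conj oO Ox)).
  by exists i => //; rewrite asboolT.
by apply: countable_bigcupT_measurable => // i; case: ifPn.
Qed.

Lemma continuous_measurable_fun2 (f : R * R -> R) :
  continuous f -> measurable_fun setT f.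
Proof.
move=> cf; refine (open_base_measurable (M := (R * R)%type) (g := id)
  (base_of_prod (@base_of_rat_itv R) (@base_of_rat_itv R)) _ cf).
by move=> i; rewrite preimage_id; apply: measurableX; exact: measurable_itv.
Qed.

Lemma continuous_measurable_fun3 (f : R * R * R -> R) :
  continuous f -> measurable_fun setT f.
Proof.
move=> cf; refine (open_base_measurable (M := (R * R * R)%type) (g := id)
  (base_of_prod (base_of_prod (@base_of_rat_itv R) (@base_of_rat_itv R))
     (@base_of_rat_itv R)) _ cf).
move=> i; rewrite preimage_id; apply: measurableX; last exact: measurable_itv.
by apply: measurableX; exact: measurable_itv.
Qed.

(** x^-1 = x exp (- ln x^2) also holds at 0, where both sides vanish. *)
Lemma measurable_invr : measurable_fun setT (fun x : R => x^-1).
Proof.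
have -> : (fun x : R => x^-1) = (fun x : R => x * expR (- ln (x ^+ 2))).
  apply/funext => x; have [->|x0] := eqVneq x 0; first by rewrite invr0 mul0r.
  by rewrite expRN lnK ?posrE ?exprn_even_gt0// expr2 invfM mulrA divff// mul1r.
apply: measurable_funM => //.
apply: (measurableT_comp (f := expR)); first exact: measurable_expR.
apply: measurable_funN; apply: (measurableT_comp (f := @ln R)); first exact: measurable_ln.
exact: measurable_funX.
Qed.

Lemma measurable_funV d (M : measurableType d) (D : set M) (f : M -> R) :
  measurable_fun D f -> measurable_fun D (fun x => (f x)^-1).
Proof. by move=> mf; apply: (measurableT_comp measurable_invr). Qed.

End continuous_measurable.

(** * Continuity, derivatives and integrals over the sphere *)

Section continuous_real_functions.
Context {R : realType} {T : topologicalType}.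
Implicit Types f g : T -> R.

Lemma ctsC (k : R) : continuous (fun _ : T => k).
Proof. by move=> x; exact: cvg_cst. Qed.

Lemma ctsD f g : continuous f -> continuous g -> continuous (fun x => f x + g x).
Proof. by move=> cf cg x; exact: (cvgD (cf x) (cg x)). Qed.

Lemma ctsN f : continuous f -> continuous (fun x => - f x).
Proof. by move=> cf x; exact: (cvgN (cf x)). Qed.

Lemma ctsM f g : continuous f -> continuous g -> continuous (fun x => f x * g x).
Proof. by move=> cf cg x; exact: (cvgM (cf x) (cg x)). Qed.

Lemma ctsX f n : continuous f -> continuous (fun x => f x ^+ n).
Proof.
move=> cf; elim: n => [|n IH]; first exact: ctsC.
by under [X in continuous X]funext do rewrite exprS; exact: ctsM.
Qed.

Lemma cts1 (k : T -> R3 R) : continuous k -> continuous (fun x => (k x).1.1).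
Proof.
move=> ck x; apply: (@continuous_comp _ _ _ k (fun y => y.1.1) x (ck x)).
by apply: continuous_comp; exact: cvg_fst.
Qed.

Lemma cts2 (k : T -> R3 R) : continuous k -> continuous (fun x => (k x).1.2).
Proof.
move=> ck x; apply: (@continuous_comp _ _ _ k (fun y => y.1.2) x (ck x)).
by apply: continuous_comp; [exact: cvg_fst|exact: cvg_snd].
Qed.

Lemma cts3 (k : T -> R3 R) : continuous k -> continuous (fun x => (k x).2).
Proof.
move=> ck x; apply: (@continuous_comp _ _ _ k (fun y => y.2) x (ck x)).
exact: cvg_snd.
Qed.

End continuous_real_functions.

Lemma cts_id (T : topologicalType) : continuous (fun x : T => x).
Proof. by move=> x; exact: cvg_id. Qed.

Ltac cts := repeat (cbv beta; first [assumption | lazymatch goal with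
  | |- continuous (fun _ => ?k) => exact: (@ctsC _ _ k)
  | |- continuous (fun u => @?f u + @?g u) => refine (@ctsD _ _ f g _ _)
  | |- continuous (fun u => @?f u * @?g u) => refine (@ctsM _ _ f g _ _)
  | |- continuous (fun u => - @?f u) => refine (@ctsN _ _ f _)
  | |- continuous (fun u => @?f u ^+ ?n) => refine (@ctsX _ _ f n _)
  | |- continuous (fun u => (@?f u).1.1) => refine (@cts1 _ _ f _)
  | |- continuous (fun u => (@?f u).1.2) => refine (@cts2 _ _ f _)
  | |- continuous (fun u => (@?f u).2) => refine (@cts3 _ _ f _)
  | |- continuous (fun u => u) => exact: cts_id
  end]).

Section pointwise_continuity.
Context {R : realType}.
Implicit Types (f g : R -> R) (c : R).

Lemma cfC c (k : R) : {for c, continuous (fun _ : R => k)}.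
Proof. exact: cvg_cst. Qed.

Lemma cfI c : {for c, continuous (fun u : R => u)}.
Proof. exact: cvg_id. Qed.

Lemma cfD c f g : {for c, continuous f} -> {for c, continuous g} ->
  {for c, continuous (fun u => f u + g u)}.
Proof. exact: cvgD. Qed.

Lemma cfN c f : {for c, continuous f} -> {for c, continuous (fun u => - f u)}.
Proof. exact: cvgN. Qed.

Lemma cfM c f g : {for c, continuous f} -> {for c, continuous g} ->
  {for c, continuous (fun u => f u * g u)}.
Proof. exact: cvgM. Qed.

Lemma cfX c f n : {for c, continuous f} -> {for c, continuous (fun u => f u ^+ n)}.
Proof.
move=> cf; elim: n => [|n IH]; first exact: cfC.
rewrite (_ : (fun u => _) = (fun u => f u * f u ^+ n)); first exact: cfM.
by apply/funext => u; rewrite exprS.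
Qed.

Lemma cfV c f : f c != 0 -> {for c, continuous f} -> {for c, continuous (fun u => (f u)^-1)}.
Proof. by move=> f0; exact: cvgV. Qed.

Lemma cf_ln c f : 0 < f c -> {for c, continuous f} -> {for c, continuous (fun u => ln (f u))}.
Proof.
move=> f0 cf; apply: (@continuous_comp _ _ _ f (@ln R)) => //.
exact: continuous_ln.
Qed.

End pointwise_continuity.

Ltac cf := repeat (cbv beta; first [assumption | lazymatch goal with
  | |- {for ?c, continuous (fun _ => ?k)} => exact: (@cfC _ c k)
  | |- {for ?c, continuous (fun u => @?f u + @?g u)} => refine (@cfD _ c f g _ _)
  | |- {for ?c, continuous (fun u => @?f u * @?g u)} => refine (@cfM _ c f g _ _)
  | |- {for ?c, continuous (fun u => - @?f u)} => refine (@cfN _ c f _)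
  | |- {for ?c, continuous (fun u => @?f u ^+ ?n)} => refine (@cfX _ c f n _)
  | |- {for ?c, continuous (fun u => (@?f u)^-1)} => refine (@cfV _ c f _ _)
  | |- {for ?c, continuous (fun u => ln (@?f u))} => refine (@cf_ln _ c f _ _)
  | |- {for ?c, continuous (fun u => u)} => exact: cfI
  end]).

Section derivatives.
Context {R : realType}.
Implicit Types (f g : R -> R) (x a b : R).
Local Notation is_der x f a := (is_derive x (1 : R) f a).

Lemma derC x (k : R) : is_der x (fun=> k) 0.
Proof. exact: is_derive_cst. Qed.

Lemma derI x : is_der x (fun u => u) 1.
Proof. exact: is_derive_id. Qed.

Lemma derD x f g a b : is_der x f a -> is_der x g b ->
  is_der x (fun u => f u + g u) (a + b).
Proof. exact: is_deriveD. Qed.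

Lemma derN x f a : is_der x f a -> is_der x (fun u => - f u) (- a).
Proof. exact: is_deriveN. Qed.

Lemma derM x f g a b : is_der x f a -> is_der x g b ->
  is_der x (fun u => f u * g u) (a * g x + f x * b).
Proof.
move=> fa gb; apply: (is_derive_eq (is_deriveM fa gb)).
by rewrite /GRing.scale/= addrC [g x * a]mulrC.
Qed.

Lemma der_comp x f g a b : is_der x f a -> is_der (f x) g b ->
  is_der x (fun u => g (f u)) (b * a).
Proof. by move=> fa gb; exact: is_derive1_comp. Qed.

Lemma derV x f a : f x != 0 -> is_der x f a ->
  is_der x (fun u => (f u)^-1) (- a / f x ^+ 2).
Proof.
move=> f0 fa; have [da ea] := fa; apply: DeriveDef; first exact: derivableV.
by rewrite deriveV// ea /GRing.scale/= !mulNr mulrC.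
Qed.

Lemma der_ln x f a : 0 < f x -> is_der x f a ->
  is_der x (fun u => ln (f u)) (a / f x).
Proof.
move=> f0 fa; have lf := is_derive1_ln f0.
by apply: (is_derive_eq (der_comp fa lf)); rewrite mulrC.
Qed.

End derivatives.

Section surface_integral.
Import HBNNSimple.
Context {R : realType}.
Local Notation mu2 := (@lebesgue_measure R \x @lebesgue_measure R)%E.
Local Notation sigma := (@surface_measure R).
Local Notation D := (@spherical_domain R).

Lemma spherical_sphere (z : R * R) : sphere (spherical z).
Proof.
rewrite /sphere /= /dot /spherical /=.
have := cos2Dsin2 z.1; have := cos2Dsin2 z.2; nra.
Qed.

Lemma continuous_dot (T : topologicalType) (f g : T -> R3 R) :
  continuous f -> continuous g -> continuous (fun x => dot (f x) (g x)).
Proof. by move=> cf cg; rewrite /dot; cts. Qed.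

Lemma continuous_dotl (p : R3 R) : continuous (fun x : R3 R => dot x p).
Proof. by apply: continuous_dot; [exact: cts_id|move=> x; exact: cvg_cst]. Qed.

Lemma continuous_dotxx : continuous (fun x : R3 R => dot x x).
Proof. by apply: continuous_dot => x. Qed.

Lemma measurable_sphere : measurable (@sphere R).
Proof.
have -> : @sphere R = (fun x : R3 R => dot x x) @^-1` [set 1] by [].
rewrite -[X in measurable X]setTI.
have: measurable_fun setT (fun x : R3 R => dot x x).
  by apply: continuous_measurable_fun3; exact: continuous_dotxx.
by apply.
Qed.

(** The surface measure is the image of sin(theta) dtheta dphi, so both sides
    agree on simple functions, and monotone convergence gives the rest. *)
Lemma ge0_integral_surfaceT (f : R3 R -> \bar R) :
  measurable_fun setT f -> (forall x, 0 <= f x)%E ->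
  (\int[sigma]_x f x = \int[mu2]_(z in D) (f (spherical z) * (sin z.1)%:E))%E.
Proof.
move=> mf f0.
have mD := @measurable_spherical_domain R.
have msin : measurable_fun setT (fun z : R * R => (sin z.1)%:E).
  apply/measurable_EFinP; apply: continuous_measurable_fun2 => z.
  by apply: continuous_comp; [exact: cvg_fst|exact: continuous_sin].
have sin0 z : D z -> (0 <= (sin z.1)%:E)%E.
  move=> [/=]; rewrite in_itv /= => /andP[z0 zpi] _.
  by rewrite lee_fin sin_ge0_pi// z0 zpi.
pose f_ := nnsfun_approx measurableT mf.
have mf_ n : measurable_fun setT (fun z : R * R => (f_ n (spherical z))%:E).
  apply/measurable_EFinP.
  exact: (measurableT_comp (measurable_funP (f_ n)) (@measurable_spherical R)).
transitivity (limn (fun n => \int[sigma]_x (f_ n x)%:E)%E).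
  rewrite -monotone_convergence//.
  - by apply: eq_integral => y _; apply/esym/cvg_lim => //; exact: cvg_nnsfun_approx.
  - by move=> n; exact/measurable_EFinP/measurable_funP.
  - by move=> n y _; rewrite lee_fin.
  - by move=> y _ m n mn; rewrite lee_fin; exact/lefP/nd_nnsfun_approx.
rewrite [X in limn X](_ : _ = (fun n =>
    \int[mu2]_(z in D) ((f_ n (spherical z))%:E * (sin z.1)%:E))%E).
  rewrite -monotone_convergence//; last 3 first.
  - move=> n /=; apply: measurable_funTS.
    by apply: emeasurable_funM => //; exact: mf_.
  - by move=> n z /sin0 z0; rewrite mule_ge0// lee_fin.
  - move=> z /sin0 z0 m n mn; rewrite lee_wpmul2r// lee_fin.
    exact/lefP/nd_nnsfun_approx.
  apply: eq_integral => z /[!inE] /sin0 z0; apply/cvg_lim => //.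
  apply: cvgeZr => //; exact: cvg_nnsfun_approx.
apply/funext => n.
have mA k : measurable (spherical @^-1` (f_ n @^-1` [set k])).
  rewrite -[X in measurable X]setTI; apply: measurable_spherical => //.
transitivity (\sum_(k \in range (f_ n))
    \int[sigma]_x (k * \1_(f_ n @^-1` [set k]) x)%:E)%E.
  under eq_integral do rewrite fimfunE -fsumEFin//.
  rewrite ge0_integral_fsum//.
  - by move=> y; exact/measurable_EFinP/measurable_funM.
  - by move=> y x _; rewrite nnfun_muleindic_ge0.
transitivity (\sum_(k \in range (f_ n))
    \int[mu2]_(z in D) ((k * \1_(f_ n @^-1` [set k]) (spherical z))%:E * (sin z.1)%:E))%E.
  apply: eq_fsbigr => r _; rewrite integralZl_indic_nnsfun// integral_indic//= setIT.
  have [r0|r0] := ltP r 0.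
    rewrite preimage_nnfun0// measure0 mule0 integral0_eq// => z _.
    by rewrite indic0 mulr0 mul0e.
  under eq_integral do rewrite EFinM -muleA.
  rewrite ge0_integralZl//; last 2 first.
  - apply: measurable_funTS; apply: emeasurable_funM => //.
    by apply/measurable_EFinP; exact: (measurable_indic (mA r)).
  - by move=> z /sin0 z0; rewrite mule_ge0// lee_fin.
  congr (_ * _)%E; rewrite /surface_measure/= integral_mkcondr.
  apply: eq_integral => z _; rewrite patchE.
  have -> : (\1_(f_ n @^-1` [set r]) (spherical z) : R) =
     \1_(spherical @^-1` (f_ n @^-1` [set r])) z by [].
  rewrite indicE; case: ifPn => _; by rewrite ?mul1e ?mul0e.
rewrite -ge0_integral_fsum//.
- apply: eq_integral => z _.
  rewrite [in RHS]fimfunE -fsumEFin// ge0_mule_fsuml// => i.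
  by rewrite nnfun_muleindic_ge0.
- move=> r; apply: measurable_funTS; apply: emeasurable_funM => //.
  apply/measurable_EFinP; apply: measurable_funM => //.
  exact: (measurable_indic (mA r)).
- by move=> r z /sin0 z0; rewrite mule_ge0// nnfun_muleindic_ge0.
Qed.

Lemma ge0_integral_surface (f : R3 R -> \bar R) :
  measurable_fun sphere f -> (forall x, sphere x -> 0 <= f x)%E ->
  (\int[sigma]_(x in sphere) f x =
   \int[mu2]_(z in D) (f (spherical z) * (sin z.1)%:E))%E.
Proof.
move=> mf f0; rewrite integral_mkcond ge0_integral_surfaceT.
- apply: eq_integral => z _; rewrite patchE mem_set//; exact: spherical_sphere.
- by apply/(measurable_restrictT _ measurable_sphere).
- by move=> x; rewrite patchE; case: ifPn => // /[!inE] /f0.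
Qed.

End surface_integral.

Section rectangle.
Context {R : realType}.
Local Notation mu := (@lebesgue_measure R).
Local Notation mu2 := (@lebesgue_measure R \x @lebesgue_measure R)%E.

Lemma integral_derive_eq0 (a b : R) (F f : R -> R) : a < b ->
  (forall x, is_derive x (1 : R) F (f x)) -> continuous f -> F a = F b ->
  (\int[mu]_(x in `[a, b]) (f x)%:E = 0)%E.
Proof.
move=> ab dF cf Fab.
have cF x : {for x, continuous F}.
  by apply/differentiable_continuous/derivable1_diffP; have [] := dF x.
rewrite (continuous_FTC2 (F := F) ab).
- by rewrite Fab subee.
- exact: continuous_subspaceT.
- split; first by move=> x _; have [] := dF x.
  + by apply: cvg_at_right_filter; exact: cF.
  + by apply: cvg_at_left_filter; exact: cF.
- by move=> x _; rewrite derive1E; have [] := dF x.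
Qed.

Context (a b c d : R).
Let D : set (R * R) := `[a, b]%classic `*` `[c, d]%classic.

Lemma measurable_rect : measurable (D : set (measurableTypeR R * measurableTypeR R)).
Proof. by apply: measurableX; exact: measurable_itv. Qed.

Lemma integrable_rect (f : R * R -> R) : continuous f ->
  mu2.-integrable D (EFin \o f).
Proof.
move=> cf; apply: measurable_bounded_integrable.
- exact: measurable_rect.
- rewrite [X in (X < _)%E](product_measure1E mu mu)//=.
  by rewrite !lebesgue_measure_itv/=; do 2 case: ifP => _;
    rewrite ?mule0 ?mul0e -?EFinB -?EFinM ltry.
- by apply: measurable_funTS; exact: continuous_measurable_fun2.
- have cD : compact D.
    by apply: compact_setX; exact: segment_compact.
  have cfD : {within D, continuous f} by exact: continuous_subspaceT.
  have [M [_ mrt]] := @compact_bounded _ R^o _ (continuous_compact cfD cD).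
  exists M; split; rewrite ?num_real // => x Mx z Dz.
  by apply: (mrt _ Mx); exists z.
Qed.

Lemma integral_rect21 (f : R * R -> R) : continuous f ->
  (\int[mu2]_(z in D) (f z)%:E =
   \int[mu]_(y in `[c, d]) \int[mu]_(x in `[a, b]) (f (x, y))%:E)%E.
Proof.
move=> cf.
have iD : mu2.-integrable setT ((EFin \o f) \_ D).
  by rewrite -integrable_mkcond; [exact: integrable_rect|exact: measurable_rect].
rewrite integral_mkcond -(integral21_prod_meas1 iD) [RHS]integral_mkcond.
apply: eq_integral => y _; rewrite /fubini_G !patchE.
case: ifPn => yc.
  rewrite [RHS]integral_mkcond; apply: eq_integral => x _; rewrite !patchE.
  by rewrite /D in_setX/= yc andbT.
rewrite integral0_eq// => x _; rewrite patchE /D in_setX/= (negbTE yc).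
by rewrite andbF.
Qed.

Lemma integral_rect12 (f : R * R -> R) : continuous f ->
  (\int[mu2]_(z in D) (f z)%:E =
   \int[mu]_(x in `[a, b]) \int[mu]_(y in `[c, d]) (f (x, y))%:E)%E.
Proof.
move=> cf.
have iD : mu2.-integrable setT ((EFin \o f) \_ D).
  by rewrite -integrable_mkcond; [exact: integrable_rect|exact: measurable_rect].
rewrite integral_mkcond -(integral12_prod_meas1 iD) [RHS]integral_mkcond.
apply: eq_integral => x _; rewrite /fubini_F !patchE.
case: ifPn => xc.
  rewrite [RHS]integral_mkcond; apply: eq_integral => y _; rewrite !patchE.
  by rewrite /D in_setX/= xc.
by rewrite integral0_eq// => y _; rewrite patchE /D in_setX/= (negbTE xc).
Qed.

End rectangle.

Section sphere_integral.
Context {R : realType}.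
Local Notation mu := (@lebesgue_measure R).
Local Notation mu2 := (@lebesgue_measure R \x @lebesgue_measure R)%E.
Local Notation sigma := (@surface_measure R).
Local Notation D := (@spherical_domain R).

Lemma continuous_spherical : continuous (@spherical R).
Proof.
have c1 (h : R -> R) : continuous h -> continuous (fun z : R * R => h z.1).
  by move=> ch z; apply: continuous_comp; [exact: cvg_fst|exact: ch].
have c2 (h : R -> R) : continuous h -> continuous (fun z : R * R => h z.2).
  by move=> ch z; apply: continuous_comp; [exact: cvg_snd|exact: ch].
have [s c] := (@continuous_sin R, @continuous_cos R).
move=> z; exact: (cvg_pair
  (cvg_pair (cvgM (c1 _ s z) (c2 _ c z)) (cvgM (c1 _ s z) (c2 _ s z))) (c1 _ c z)).
Qed.

Lemma compact_sphere : compact (@sphere R).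
Proof.
apply: (@subclosed_compact _ _
  (`[-1, 1]%classic `*` `[-1, 1]%classic `*` `[-1, 1]%classic : set (R3 R))).
- exact: (@preimage_closed _ _ _ _ (in1W continuous_dotxx) (@closed_eq _ 1)).
- by apply: compact_setX; [apply: compact_setX|]; exact: segment_compact.
- move=> [[x1 x2] x3]; rewrite /sphere /dot/= => xx.
  by rewrite !in_itv/=; split; [split|]; apply/andP; split; nra.
Qed.

Lemma bounded_on_sphere (h : R3 R -> R) : continuous h ->
  exists2 M, 0 <= M & forall x, sphere x -> `|h x| <= M.
Proof.
move=> ch; have chS : {within sphere, continuous h} by exact: continuous_subspaceT.
have [M [Mr mrt]] := @compact_bounded _ R^o _ (continuous_compact chS compact_sphere).
exists (`|M| + 1) => [|x Sx]; first by rewrite addr_ge0.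
by apply: mrt; [rewrite ltr_pwDr// ler_norm|exists x].
Qed.

Lemma surface_measure_fin : (sigma sphere < +oo)%E.
Proof.
rewrite [X in (X < _)%E](_ : _ = (\int[mu2]_(z in D) (sin z.1)%:E)%E).
  have cs : continuous (fun z : R * R => sin z.1).
    by move=> z; apply: continuous_comp; [exact: cvg_fst|exact: continuous_sin].
  have := integrable_rect 0 pi 0 (pi *+ 2) cs.
  by move/integrable_fin_num => /(_ (measurable_rect _ _ _ _)); rewrite fin_numElt => /andP[].
rewrite /= /surface_measure (_ : spherical @^-1` sphere = setT) ?setIT//.
by apply/seteqP; split => // z _; exact: spherical_sphere.
Qed.

Lemma integrable_sphere (h : R3 R -> R) : measurable_fun sphere h ->
  (exists M, forall x, sphere x -> `|h x| <= M) ->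
  sigma.-integrable sphere (EFin \o h).
Proof.
move=> mh [M hM]; apply: measurable_bounded_integrable => //.
- exact: measurable_sphere.
- exact: surface_measure_fin.
- by exists M; split; rewrite ?num_real// => x Mx y /hM /le_trans; apply; exact: ltW.
Qed.

Lemma continuous_integrable_sphere (h : R3 R -> R) : continuous h ->
  sigma.-integrable sphere (EFin \o h).
Proof.
move=> ch; apply: integrable_sphere.
  by apply: measurable_funTS; exact: continuous_measurable_fun3.
by have [M _ ?] := bounded_on_sphere ch; exists M.
Qed.

Lemma integral_surface (h : R3 R -> R) : continuous h ->
  (\int[sigma]_(x in sphere) (h x)%:E =
   \int[mu2]_(z in D) (h (spherical z) * sin z.1)%:E)%E.
Proof.
move=> ch; have mh : measurable_fun sphere (EFin \o h).
  by apply/measurable_EFinP; apply: measurable_funTS; exact: continuous_measurable_fun3.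
have sin0 z : D z -> 0 <= sin z.1.
  move=> [/=]; rewrite in_itv /= => /andP[z0 zpi] _.
  by rewrite sin_ge0_pi// z0 zpi.
rewrite integralE [RHS]integralE; congr (_ - _)%E.
- rewrite ge0_integral_surface//; last exact: measurable_funepos.
  apply: eq_integral => z /[!inE] /sin0 z0; rewrite !funeposE /= -!EFin_max -EFinM.
  by rewrite maxr_pMl// mul0r.
- rewrite ge0_integral_surface//; last exact: measurable_funeneg.
  apply: eq_integral => z /[!inE] /sin0 z0; rewrite !funenegE /= -!EFin_max -EFinM.
  by rewrite maxr_pMl// mul0r mulNr.
Qed.

End sphere_integral.

(** * The divergence theorem for the fields p - (x.p) x *)

Section divergence.
Context {R : realType}.
Local Notation mu := (@lebesgue_measure R).
Local Notation mu2 := (@lebesgue_measure R \x @lebesgue_measure R)%E.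
Local Notation sigma := (@surface_measure R).
Local Notation D := (@spherical_domain R).

(** The chain rule along a curve given by its coordinates, as needed to
    differentiate G o spherical in one of its two variables. *)
Lemma is_derive_along_curve (G : R3 R -> R) (DG : R3 R -> R3 R)
    (g1 g2 g3 : R -> R) (t a b c : R) :
  is_diff (g1 t, g2 t, g3 t) G (dot (DG (g1 t, g2 t, g3 t))) ->
  is_derive t (1 : R) g1 a -> is_derive t (1 : R) g2 b -> is_derive t (1 : R) g3 c ->
  is_derive t (1 : R) (fun u => G (g1 u, g2 u, g3 u))
    (dot (DG (g1 t, g2 t, g3 t)) (a, b, c)).
Proof.
move=> dG d1 d2 d3.
have diff (g : R -> R) v : is_derive t (1 : R) g v ->
    differentiable g t /\ 'd g t (1 : R) = v.
  move=> dg; have dif : differentiable g t by apply/derivable1_diffP; case: dg.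
  by split => //; rewrite -deriveE//; case: dg.
have [[D1 E1] [D2 E2] [D3 E3]] := And3 (diff _ _ d1) (diff _ _ d2) (diff _ _ d3).
pose g u := (g1 u, g2 u, g3 u).
have Dg : is_diff t g (fun v : R => ('d g1 t v, 'd g2 t v, 'd g3 t v)).
  by apply: is_diff_pair; [apply: is_diff_pair|]; exact: differentiableP.
have DGg : is_diff t (G \o g) (dot (DG (g t)) \o (fun v : R => ('d g1 t v, 'd g2 t v, 'd g3 t v))).
  exact: is_diff_comp.
apply: DeriveDef.
  by apply/derivable1_diffP; case: DGg.
rewrite deriveE; last by case: DGg.
by case: DGg => _ ->; rewrite /= E1 E2 E3.
Qed.

(** The integrand is the divergence on the sphere of G times the tangential field
    p - (x.p) x.  In spherical coordinates its product with the density
    sin(theta) is the theta-derivative of sin(theta) a G plus the phi-derivative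
    of b G, where a and b are the components of the field along meridians and
    parallels.  The first function vanishes at the end points of [0, pi] and the
    second is 2 pi-periodic, so both integrals are zero. *)
Theorem divergence_sphere (p : R3 R) (G : R3 R -> R) (DG : R3 R -> R3 R) :
  (forall x, is_diff x G (dot (DG x))) -> continuous DG ->
  (\int[sigma]_(x in sphere)
    (dot (DG x) (p - dot x p *: x) - 2 * dot x p * G x)%:E = 0)%E.
Proof.
move=> dG cDG.
have cG : continuous G.
  by move=> x; apply: differentiable_continuous; case: (dG x).
case: p => -[p1 p2] p3.
have c1 (h : R -> R) : continuous h -> continuous (fun z : R * R => h z.1).
  by move=> ch z; apply: continuous_comp; [exact: cvg_fst|exact: ch].
have c2 (h : R -> R) : continuous h -> continuous (fun z : R * R => h z.2).
  by move=> ch z; apply: continuous_comp; [exact: cvg_snd|exact: ch].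
have cs1 := c1 _ (@continuous_sin R); have cc1 := c1 _ (@continuous_cos R).
have cs2 := c2 _ (@continuous_sin R); have cc2 := c2 _ (@continuous_cos R).
have cGs : continuous (fun z : R * R => G (spherical z)).
  by move=> z; apply: continuous_comp; [exact: continuous_spherical|exact: cG].
have cDGs : continuous (fun z : R * R => DG (spherical z)).
  by move=> z; apply: continuous_comp; [exact: continuous_spherical|exact: cDG].
pose H x := dot (DG x) ((p1, p2, p3) - dot x (p1, p2, p3) *: x) - 2 * dot x (p1, p2, p3) * G x.
pose ga z : R := dot (DG (spherical z)) (cos z.1 * cos z.2, cos z.1 * sin z.2, - sin z.1).
pose gb z : R := dot (DG (spherical z)) (sin z.1 * - sin z.2, sin z.1 * cos z.2, 0).
pose a (z : R * R) : R := cos z.1 * cos z.2 * p1 + cos z.1 * sin z.2 * p2 - sin z.1 * p3.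
pose a' (z : R * R) : R := - sin z.1 * cos z.2 * p1 - sin z.1 * sin z.2 * p2 - cos z.1 * p3.
pose b (z : R * R) : R := - sin z.2 * p1 + cos z.2 * p2.
pose b' (z : R * R) : R := - cos z.2 * p1 - sin z.2 * p2.
pose dA z := (cos z.1 * a z + sin z.1 * a' z) * G (spherical z) + sin z.1 * a z * ga z.
pose dB z := b' z * G (spherical z) + b z * gb z.
have ca : continuous a by rewrite /a; cts.
have cb : continuous b by rewrite /b; cts.
have cga : continuous ga by rewrite /ga /dot /=; cts.
have cgb : continuous gb by rewrite /gb /dot /=; cts.
have ca' : continuous a' by rewrite /a'; cts.
have cb' : continuous b' by rewrite /b'; cts.
have cdA : continuous dA by rewrite /dA; cts.
have cdB : continuous dB by rewrite /dB; cts.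
(* Both sides are polynomials in the sines and cosines; they agree modulo the
   two relations cos^2 + sin^2 = 1. *)
have HE z : H (spherical z) * sin z.1 = dA z + dB z.
  rewrite /H /dA /dB /ga /gb /a /a' /b /b' /dot /GRing.scale /= /GRing.scale /=.
  have := cos2Dsin2 z.1; have := cos2Dsin2 z.2.
  case: (DG (spherical z)) => -[q1 q2] q3 /=.
  move: (sin z.1) (cos z.1) (sin z.2) (cos z.2) (G (spherical z)) =>
    s1 k1 s2 k2 g E2 E1.
  apply/eqP; rewrite -subr_eq0; apply/eqP.
  pose u1 := q1 * k2 + q2 * s2; pose u2 := p1 * k2 + p2 * s2.
  transitivity (- (k1 ^+ 2 + s1 ^+ 2 - 1) * (s1 * (u1 * u2 + q3 * p3) + g * u2)
    - (k2 ^+ 2 + s2 ^+ 2 - 1) * (s1 * (q1 * p1 + q2 * p2))).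
    by rewrite /u1 /u2; ring.
  by rewrite E1 E2; ring.
have dGa (f t : R) : is_derive t (1 : R) (fun u => G (spherical (u, f))) (ga (t, f)).
  apply: (is_derive_along_curve (g1 := fun u => sin u * cos f)
    (g2 := fun u => sin u * sin f) (g3 := @cos R) (dG _)).
  - apply: (is_derive_eq (derM (is_derive_sin t) (derC t (cos f)))); by ring.
  - apply: (is_derive_eq (derM (is_derive_sin t) (derC t (sin f)))); by ring.
have dGb (f t : R) : is_derive f (1 : R) (fun u => G (spherical (t, u))) (gb (t, f)).
  exact: (is_derive_along_curve (g1 := fun u => sin t * cos u)
    (g2 := fun u => sin t * sin u) (g3 := fun=> cos t) (dG _)).
have cH : continuous H.
  by rewrite /H /dot /=; cts; rewrite /GRing.scale /=; cts.
rewrite (integral_surface cH).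
under eq_integral do rewrite HE EFinD.
rewrite integralD//=; last 3 first.
- exact: measurable_rect.
- exact: integrable_rect.
- exact: integrable_rect.
rewrite integral_rect21// integral_rect12//.
have slice1 (f : R) (h : R * R -> R) : continuous h -> continuous (fun u => h (u, f)).
  move=> ch u; apply: (@continuous_comp _ _ _ (fun u => (u, f)) h); last exact: ch.
  exact: (cvg_pair cvg_id (cvg_cst _)).
have slice2 (f : R) (h : R * R -> R) : continuous h -> continuous (fun u => h (f, u)).
  move=> ch u; apply: (@continuous_comp _ _ _ (fun u => (f, u)) h); last exact: ch.
  exact: (cvg_pair (cvg_cst _) cvg_id).
rewrite integral0_eq ?add0e; last first.
  move=> f _; apply: (integral_derive_eq0
    (F := fun u => sin u * a (u, f) * G (spherical (u, f)))).
  - exact: pi_gt0.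
  - move=> t; rewrite /a /=.
    have d1 (k : R) : is_derive t (1 : R) (fun u => cos u * k) (- sin t * k).
      by apply: (is_derive_eq (derM (is_derive_cos t) (derC t k))); ring.
    have dcc : is_derive t (1 : R) (fun u => cos u * cos f * p1 + cos u * sin f * p2 - sin u * p3) (a' (t, f)).
      apply: (is_derive_eq (derD (derD (derM (d1 (cos f)) (derC t p1))
        (derM (d1 (sin f)) (derC t p2))) (derN (derM (is_derive_sin t) (derC t p3))))).
      by rewrite /a'/=; ring.
    apply: (is_derive_eq (derM (derM (is_derive_sin t) dcc) (dGa f t))).
    by rewrite /dA /a /=.
  - exact: slice1.
  - by rewrite sin0 sinpi !mul0r.
rewrite integral0_eq// => t _; apply: (integral_derive_eq0
    (F := fun u => b (t, u) * G (spherical (t, u)))).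
- by rewrite mulrn_wgt0// pi_gt0.
- move=> f; rewrite /b /=.
  apply: (is_derive_eq (derM (derD (derM (derN (is_derive_sin f)) (derC f p1))
    (derM (is_derive_cos f) (derC f p2))) (dGb f t))).
  by rewrite /dB /b /b' /=; ring.
- exact: slice2.
- by rewrite /b /spherical/= sin0 cos0 sin2pi cos2pi.
Qed.

End divergence.

(** * Gradients and smooth functions *)

Section gradients.
Context {R : realType}.
Implicit Types (F G : R3 R -> R) (DF DG : R3 R -> R3 R) (x v p : R3 R).

Definition has_grad F DF := forall x, is_diff x F (dot (DF x)).

Lemma R3_eq x v : x.1.1 = v.1.1 -> x.1.2 = v.1.2 -> x.2 = v.2 -> x = v.
Proof. by move: x v => [[? ?] ?] [[? ?] ?] /= -> -> ->. Qed.

Lemma dotC x v : dot x v = dot v x.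
Proof. by rewrite /dot; ring. Qed.

Lemma dotDl x v p : dot (x + v) p = dot x p + dot v p.
Proof. by rewrite /dot/=; ring. Qed.

Lemma dotZl (k : R) x p : dot (k *: x) p = k * dot x p.
Proof. by rewrite /dot/= /GRing.scale/=; ring. Qed.

Lemma dotBl x v p : dot (x - v) p = dot x p - dot v p.
Proof. by rewrite /dot/=; ring. Qed.

Lemma dotl_is_linear p : linear (fun x : R3 R => dot x p : R^o).
Proof. by move=> k x v; rewrite dotDl dotZl. Qed.

Lemma has_grad_dotl p : has_grad (fun x => dot x p) (fun=> p).
Proof.
move=> x.
pose f := (fun x : R3 R => dot x p : R^o).
pose H := GRing.isLinear.Build _ _ _ _ f (dotl_is_linear p).
pose g : {linear R3 R -> R^o} := HB.pack f H.
have cg : continuous g by exact: continuous_dotl.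
have := @diff_lin _ _ _ g x cg; have := @linear_differentiable _ _ _ g x cg.
move=> dg eg; apply: DiffDef => //; rewrite eg; apply/funext => v /=.
by rewrite /f dotC.
Qed.

Lemma has_grad_eq F DF DG : has_grad F DF -> DF =1 DG -> has_grad F DG.
Proof. by move=> + /funext <-. Qed.

Lemma has_gradC (k : R) : has_grad (fun=> k) (fun=> 0).
Proof.
move=> x; have := is_diff_cst (k : R^o) x; rewrite (_ : 0 = dot 0) //.
by apply/funext => v; rewrite /dot/= !mul0r !addr0.
Qed.

Lemma has_gradD F G DF DG : has_grad F DF -> has_grad G DG ->
  has_grad (fun x => F x + G x) (fun x => DF x + DG x).
Proof.
move=> hF hG x; apply: is_diff_eq; first exact: is_diffD.
by apply/funext => v; rewrite dotDl.
Qed.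

Lemma has_gradM F G DF DG : has_grad F DF -> has_grad G DG ->
  has_grad (fun x => F x * G x) (fun x => F x *: DG x + G x *: DF x).
Proof.
move=> hF hG x; apply: is_diff_eq; first exact: is_diffM.
by apply/funext => v; rewrite dotDl !dotZl.
Qed.

Lemma has_grad_comp F DF (h h' : R -> R) : has_grad F DF ->
  (forall x, is_derive (F x) (1 : R) h (h' (F x))) ->
  has_grad (fun x => h (F x)) (fun x => h' (F x) *: DF x).
Proof.
move=> hF hh x; have dh : differentiable h (F x).
  by apply/derivable1_diffP; case: (hh x).
have dh' : is_diff (F x) h ( *%R (h' (F x))).
  apply: DiffDef => //; rewrite (@deriv1E R R^o); last by case: (hh x).
  by rewrite derive1E; have [_ ->] := hh x; apply/funext => v; rewrite /GRing.scale/= mulrC.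
apply: is_diff_eq; first exact: (@is_diff_comp _ _ _ _ F _ h _ x (hF x) dh').
by apply/funext => v; rewrite /= dotZl.
Qed.

Lemma has_grad_derive F DF x v : has_grad F DF ->
  differentiable F x /\ 'D_v F x = dot (DF x) v.
Proof. by move=> /(_ x)[dF eF]; split => //; rewrite deriveE// eF. Qed.

Lemma has_grad_gradient F : (forall x, differentiable F x) -> has_grad F (gradient F).
Proof.
move=> dF x; apply: DiffDef => //; apply/funext => -[[v1 v2] v3].
rewrite /gradient !deriveE// /dot/=.
have -> : (v1, v2, v3) = v1 *: ((1, 0, 0) : R3 R) + v2 *: ((0, 1, 0) : R3 R) + v3 *: ((0, 0, 1) : R3 R).
  by apply: R3_eq; rewrite /= /GRing.scale/=; ring.
by rewrite !linearD !linearZ /= [_ * v1]mulrC [_ * v2]mulrC [_ * v3]mulrC.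
Qed.

(** Directional derivatives up to order n exist and are differentiable.  Being
    stable under sums, products and compositions by induction on n, this is the
    form in which smoothness of the test functions is established. *)
Fixpoint Cn (n : nat) F : Prop :=
  if n is n'.+1 then
    (forall x, differentiable F x) /\ (forall v, Cn n' (fun x => 'D_v F x))
  else forall x, differentiable F x.

Lemma CnS n F : Cn n.+1 F -> Cn n F.
Proof.
elim: n F => [|n IH] F /= [dF DF]; first exact: dF.
by split => // v; apply: IH; exact: DF.
Qed.

Lemma Cn_ext n F G : F =1 G -> Cn n F -> Cn n G.
Proof. by move/funext => ->. Qed.

Lemma Cn_smooth F : (forall n, Cn n F) -> smooth F.
Proof.
move=> CF vs; have : forall n, Cn n (foldr (fun v (h : R3 R -> R) y => 'D_v h y) F vs).
  by elim: vs => //= v vs IH n; have [_] := IH n.+1; apply.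
by move=> /(_ 0%N).
Qed.

Lemma CnC n (k : R) : Cn n (fun=> k).
Proof.
elim: n k => [|n IH] k /=; first by move=> x; exact: (differentiable_cst (k : R^o)).
split=> [x|v]; first exact: (differentiable_cst (k : R^o)).
by apply: (@Cn_ext _ (fun=> 0)) => // x; apply/esym/(derive_cst (k : R^o)).
Qed.

Lemma CnD n F G : Cn n F -> Cn n G -> Cn n (fun x => F x + G x).
Proof.
elim: n F G => [|n IH] F G.
  by move=> dF dG x; exact: (@differentiableD _ _ _ (F : R3 R -> R^o) G).
move=> [dF DF] [dG DG]; split.
  by move=> x; exact: (@differentiableD _ _ _ (F : R3 R -> R^o) G).
move=> v; apply: (@Cn_ext _ (fun x => 'D_v F x + 'D_v G x)); last first.
  by apply: IH; [exact: DF|exact: DG].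
by move=> x; rewrite -deriveD//; exact: diff_derivable.
Qed.

Lemma CnM n F G : Cn n F -> Cn n G -> Cn n (fun x => F x * G x).
Proof.
elim: n F G => [|n IH] F G.
  by move=> dF dG x; exact: differentiableM.
move=> CF CG; have [dF DF] := CF; have [dG DG] := CG; split.
  by move=> x; exact: differentiableM.
move=> v; apply: (@Cn_ext _ (fun x => F x * 'D_v G x + G x * 'D_v F x)).
  by move=> x; rewrite -deriveM//; exact: diff_derivable.
by apply: CnD; apply: IH; [exact: CnS|exact: DG|exact: CnS|exact: DF].
Qed.

(** A derivative of h o F is h' o F times a derivative of F.  Smoothness of h' o F
    may be deduced from that of h o F at lower order, which settles functions
    whose derivative is an expression in the function itself, such as the
    inverse and the square root. *)
Lemma Cn_comp n F (h h' : R -> R) :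
  (forall x, is_derive (F x) (1 : R) h (h' (F x))) ->
  Cn n F -> (forall m, (m < n)%N -> Cn m (fun x => h (F x)) -> Cn m (fun x => h' (F x))) ->
  Cn n (fun x => h (F x)).
Proof.
move=> hh; have dhF : (forall x, differentiable F x) ->
    forall x, differentiable (fun x => h (F x)) x.
  move=> dF x; have := has_grad_comp (has_grad_gradient dF) hh.
  by move=> /(_ x)[].
elim: n => [|n IH] CF Ch'; first exact: dhF.
have [dF DF] := CF; split; first exact: dhF.
have Cn_hF : Cn n (fun x => h (F x)).
  by apply: IH => [|m mn]; [exact: CnS|apply: Ch'; exact: ltnW].
move=> v; apply: (@Cn_ext _ (fun x => h' (F x) * 'D_v F x)).
  move=> x; have [_ ->] := has_grad_derive x v (has_grad_comp (has_grad_gradient dF) hh).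
  by have [_ ->] := has_grad_derive x v (has_grad_gradient dF); rewrite dotZl.
by apply: CnM; [exact: Ch'|exact: DF].
Qed.

Lemma Cn_inv n F : (forall x, F x != 0) -> Cn n F -> Cn n (fun x => (F x)^-1).
Proof.
move=> F0 CF; apply: (@Cn_comp _ _ _ (fun t => - (t^-1 * t^-1))) => //.
  move=> x; apply: (is_derive_eq (derV (F0 x) (derI (F x)))).
  by rewrite mulN1r expr2 invfM.
by move=> m mn Cm; apply: (@Cn_ext _ (fun x => -1 * ((F x)^-1 * (F x)^-1))) => [x|];
  [rewrite mulN1r|apply: CnM; [exact: CnC|exact: CnM]].
Qed.

Lemma Cn_le m n F : (m <= n)%N -> Cn n F -> Cn m F.
Proof.
elim: n => [|n IH]; first by rewrite leqn0 => /eqP ->.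
rewrite leq_eqVlt ltnS => /orP[/eqP->//|mn /CnS]; exact: IH.
Qed.

Lemma Cn_ln n F : (forall x, 0 < F x) -> Cn n F -> Cn n (fun x => ln (F x)).
Proof.
move=> F0 CF; apply: (@Cn_comp _ _ _ (fun t => t^-1)) => //.
  by move=> x; exact: is_derive1_ln.
move=> m mn _; apply: Cn_inv => [x|]; first by rewrite gt_eqF.
by apply: Cn_le CF; exact: ltnW.
Qed.

Lemma Cn_sqrt n F : (forall x, 0 < F x) -> Cn n F -> Cn n (fun x => Num.sqrt (F x)).
Proof.
move=> F0 CF; apply: (@Cn_comp _ _ _ (fun t => (2 * Num.sqrt t)^-1)) => //.
  by move=> x; exact: is_derive1_sqrt.
move=> m mn Cm; apply: Cn_inv => [x|]; last by apply: CnM => //; exact: CnC.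
by rewrite mulf_neq0// gt_eqF// sqrtr_gt0.
Qed.

Lemma Cn_dotl n p : Cn n (fun x => dot x p).
Proof.
have d1 x : differentiable (fun x : R3 R => dot x p) x by case: (has_grad_dotl p x).
case: n => [|n]; first exact: d1.
split => // v; apply: (@Cn_ext _ (fun=> dot p v)); last exact: CnC.
by move=> x; have [_ ->] := has_grad_derive x v (has_grad_dotl p).
Qed.

End gradients.

(** * Radial functions *)

Section radial.
Context {R : realType}.
Implicit Types (F G : R3 R -> R) (DF DG : R3 R -> R3 R) (x v p : R3 R).
Local Notation sigma := (@surface_measure R).

Lemma ctsDv (f g : R3 R -> R3 R) : continuous f -> continuous g -> continuous (fun x => f x + g x).
Proof. by move=> cf cg x; exact: (cvgD (cf x) (cg x)). Qed.

Lemma ctsZv (k : R3 R -> R) (g : R3 R -> R3 R) :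
  continuous k -> continuous g -> continuous (fun x => k x *: g x).
Proof. by move=> ck cg x; exact: (cvgZ (ck x) (cg x)). Qed.

Lemma ctsV (T : topologicalType) (f : T -> R) : (forall t, f t != 0) -> continuous f ->
  continuous (fun t => (f t)^-1).
Proof. by move=> f0 cf t; exact: (cvgV (f0 t) (cf t)). Qed.

Lemma cts_comp (T : topologicalType) (f : T -> R) (h : R -> R) : continuous f ->
  (forall t, {for f t, continuous h}) -> continuous (fun t => h (f t)).
Proof. by move=> cf ch t; exact: (@continuous_comp _ _ _ f h t (cf t) (ch t)). Qed.

Lemma dot_ge0 x : 0 <= dot x x.
Proof. by rewrite /dot; nra. Qed.

Lemma dot_sqrD x p : dot (x + p) (x + p) = dot x x + 2 * dot x p + dot p p.
Proof. by rewrite /dot/=; ring. Qed.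

Lemma dot_sqrB x p : dot (x - p) (x - p) = dot x x - 2 * dot x p + dot p p.
Proof. by rewrite /dot/=; ring. Qed.

Lemma dot_sphere_bound x p : sphere x -> sphere p -> -1 <= dot x p <= 1.
Proof.
rewrite /sphere /= => xx pp; have := dot_ge0 (x + p); have := dot_ge0 (x - p).
rewrite dot_sqrB dot_sqrD xx pp.
by move=> *; apply/andP; split; lra.
Qed.

(** The cosine of the angle to p, extended from the sphere to a smooth function
    on the whole space that still takes its values in [-1, 1]: functions of it
    that are only smooth on [-1, 1] are then smooth everywhere. *)
Definition cosp p x : R := 2 * dot x p / (1 + dot x x).

Lemma cosp_sphere p x : sphere x -> cosp p x = dot x p.
Proof. by rewrite /sphere /cosp /= => ->; field. Qed.

Lemma cosp_bound p x : sphere p -> -1 <= cosp p x <= 1.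
Proof.
rewrite /sphere /= => pp; have := dot_ge0 (x + p); have := dot_ge0 (x - p).
rewrite dot_sqrB dot_sqrD pp.
have := dot_ge0 x => x0 h1 h2; have d0 : 0 < 1 + dot x x by lra.
by rewrite /cosp ler_pdivlMr// ler_pdivrMr//; apply/andP; split; lra.
Qed.

Definition gradient_cosp p x : R3 R :=
  (2 / (1 + dot x x)) *: p + (- (4 * dot x p / (1 + dot x x) ^+ 2)) *: x.

Lemma has_grad_dotxx : has_grad (fun x : R3 R => dot x x) (fun x => 2 *: x).
Proof.
pose e1 : R3 R := (1, 0, 0); pose e2 : R3 R := (0, 1, 0); pose e3 : R3 R := (0, 0, 1).
have sq (e : R3 R) := has_gradM (has_grad_dotl e) (has_grad_dotl e).
have := has_gradD (has_gradD (sq e1) (sq e2)) (sq e3).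
rewrite (_ : (fun x => _ + _) = (fun x => dot x x)); last first.
  by apply/funext => x; rewrite /dot /e1 /e2 /e3/=; ring.
move/has_grad_eq; apply => x.
by apply: R3_eq; rewrite /dot /= /GRing.scale/=; ring.
Qed.

Lemma dotxx1_neq0 x : 1 + dot x x != 0.
Proof. by rewrite gt_eqF// ltr_pwDl// dot_ge0. Qed.

Lemma has_grad_cosp p : has_grad (cosp p) (gradient_cosp p).
Proof.
have h1 := has_gradM (has_gradC 2) (has_grad_dotl p).
have h2 := has_gradD (has_gradC 1) has_grad_dotxx.
have h3 : has_grad (fun x : R3 R => (1 + dot x x)^-1)
    (fun x => (- (1 + dot x x) ^- 2) *: (0 + 2 *: x)).
  apply: (has_grad_comp (h := fun t => t^-1) (h' := fun t => - (t ^- 2)) h2) => x.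
  apply: (is_derive_eq (derV (f := fun t => t) (dotxx1_neq0 x) (derI _))).
  by rewrite mulN1r.
apply: has_grad_eq; first exact: (has_gradM h1 h3).
move=> x; have x0 := dotxx1_neq0 x; apply: R3_eq;
  by rewrite /gradient_cosp /= /GRing.scale/= /GRing.scale/=; field.
Qed.

Lemma gradient_cosp_sphere p x : sphere x -> gradient_cosp p x = p - dot x p *: x.
Proof.
rewrite /sphere /gradient_cosp/= => ->.
by apply: R3_eq; rewrite /= /GRing.scale/=; field.
Qed.

Lemma continuous_cosp p : continuous (cosp p).
Proof. by move=> x; apply: differentiable_continuous; case: (has_grad_cosp p x). Qed.

Lemma continuous_gradient_cosp p : continuous (gradient_cosp p).
Proof.
have cd : continuous (fun x : R3 R => 1 + dot x x).
  by cts; exact: continuous_dotxx.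
have cdV := ctsV dotxx1_neq0 cd.
apply: ctsDv; apply: ctsZv; try exact: cts_id; try by move=> x; exact: cvg_cst.
  by cts.
cts; first exact: continuous_dotl.
by apply: ctsV => [x|]; [rewrite expf_neq0// dotxx1_neq0|apply: ctsX].
Qed.

Lemma dot_tangent p x : sphere x -> sphere p ->
  dot (p - dot x p *: x) (p - dot x p *: x) = 1 - dot x p ^+ 2.
Proof.
rewrite /sphere /= => xx pp.
by rewrite dotBl dotZl [dot p _]dotC [dot x (_ - _)]dotC !dotBl !dotZl xx pp [dot p x]dotC; ring.
Qed.

(** The case G = F h(cosp p) of divergence_sphere: on the sphere the gradient of
    h(cosp p) pairs with the field p - (x.p) x to h'(c) (1 - c^2). *)
Lemma divergence_radial p F DF (h h' : R -> R) : sphere p ->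
  has_grad F DF -> continuous DF ->
  (forall c : R, -1 <= c <= 1 -> is_derive c (1 : R) h (h' c)) ->
  (forall c : R, -1 <= c <= 1 -> {for c, continuous h'}) ->
  (\int[sigma]_(x in sphere)
    (h (dot x p) * dot (DF x) (p - dot x p *: x) +
     F x * (h' (dot x p) * (1 - dot x p ^+ 2) - 2 * dot x p * h (dot x p)))%:E = 0)%E.
Proof.
move=> pp gF cDF dh ch'.
have gh := has_grad_comp (has_grad_cosp p) (fun x => dh _ (cosp_bound x pp)).
have gG := has_gradM gF gh.
have ch : continuous (fun x => h (cosp p x)).
  by move=> x; apply: differentiable_continuous; case: (gh x).
have cF : continuous F.
  by move=> x; apply: differentiable_continuous; case: (gF x).
have cG : continuous (fun x => F x *: (h' (cosp p x) *: gradient_cosp p x) + h (cosp p x) *: DF x).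
  apply: ctsDv; apply: ctsZv => //; apply: ctsZv; last exact: continuous_gradient_cosp.
  by apply: cts_comp; [exact: continuous_cosp|move=> x; apply: ch'; exact: cosp_bound].
rewrite -[RHS](divergence_sphere p gG cG); apply: eq_integral => x /[!inE] Sx.
congr EFin; rewrite gradient_cosp_sphere// cosp_sphere// dotDl !dotZl dot_tangent//.
by ring.
Qed.

End radial.

(** * Ground states and Hardy inequalities *)

Section ground_state.
Context {R : realType}.
Implicit Types (F f : R3 R -> R) (g : R3 R -> R3 R) (x v p : R3 R) (c : R).
Local Notation sigma := (@surface_measure R).

(** Y is the logarithmic derivative u'/u of a positive function u of c = x.p, and
    the last condition says that - Delta u >= (N - C / 4) u: for such u,
    Delta u / u = (1 - c^2) (Y' + Y^2) - 2 c Y on the sphere.  The condition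
    0 <= Y' + Y^2, that is u'' >= 0, makes the inequality stable under
    replacing u(c) by u(t c) with t < 1. *)
Definition ground_state (C : R) (Y Y' N : R -> R) :=
  forall c, -1 < c < 1 ->
    [/\ is_derive c (1 : R) Y (Y' c), {for c, continuous Y'} /\ {for c, continuous N},
        0 <= N c, 0 <= Y' c + Y c ^+ 2 &
        (1 - c ^+ 2) * (Y' c + Y c ^+ 2) - 2 * c * Y c + N c <= C / 4].

Lemma smooth_has_grad F : smooth F ->
  has_grad F (gradient F) /\ continuous (gradient F).
Proof.
move=> sF; split; first by apply: has_grad_gradient => x; exact: (sF [::] x).
have cD v : continuous (fun x => 'D_v F x).
  by move=> x; apply: differentiable_continuous; exact: (sF [:: v] x).
by move=> x; exact: (cvg_pair (cvg_pair (cD _ x) (cD _ x)) (cD _ x)).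
Qed.

Lemma continuous_sphere_gradient F : smooth F -> continuous (sphere_gradient F).
Proof.
move=> /smooth_has_grad[_ cD]; apply: ctsDv => //.
move=> x; apply: cvgN; apply: (ctsZv (k := fun x => dot (gradient F x) x)).
  by apply: continuous_dot => //; exact: cts_id.
exact: cts_id.
Qed.

Lemma continuous_smooth F : smooth F -> continuous F.
Proof. by move=> sF x; apply: differentiable_continuous; exact: (sF [::] x). Qed.

Lemma dilate_in_oo (t c : R) : 0 <= t < 1 -> -1 <= c <= 1 -> -1 < t * c < 1.
Proof. by move=> /andP[t0 t1] /andP[c0 c1]; apply/andP; split; nra. Qed.

Lemma continuous_Ncosp C Y Y' N p t : sphere p -> ground_state C Y Y' N -> 0 <= t < 1 ->
  continuous (fun x => N (t * cosp p x)).
Proof.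
move=> pp gs t01; apply: cts_comp.
  by apply: ctsM; [exact: ctsC|exact: continuous_cosp].
by move=> x; have [_ []] := gs _ (dilate_in_oo t01 (cosp_bound x pp)).
Qed.

Lemma measurable_cts F : continuous F -> measurable_fun sphere F.
Proof. by move=> cF; apply: measurable_funTS; exact: continuous_measurable_fun3. Qed.

(** Integrate |grad F - F h(c) (p - c x)|^2 >= 0 for h(c) = t Y(t c); the cross
    term is turned by the divergence theorem into a multiple of F^2.  Dilation
    costs nothing since t^2 (1 - c^2) <= 1 - (t c)^2. *)
Lemma ground_state_smooth C Y Y' N p F t : sphere p ->
  ground_state C Y Y' N -> 0 <= t < 1 -> smooth F ->
  (\int[sigma]_(x in sphere) (F x ^+ 2 * N (t * dot x p))%:E
     <= T C F (sphere_gradient F))%E.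
Proof.
move=> pp gs t01 sF.
have [gF cDF] := smooth_has_grad sF; have cF := continuous_smooth sF.
have csg := continuous_sphere_gradient sF.
pose h c := t * Y (t * c); pose h' c := t ^+ 2 * Y' (t * c).
have tb c : -1 <= c <= 1 -> -1 < t * c < 1 by move=> cb; exact: dilate_in_oo.
have dh c : -1 <= c <= 1 -> is_derive c (1 : R) h (h' c).
  move=> /tb cb; have [dY _ _ _ _] := gs _ cb.
  have d1 : is_derive c (1 : R) (fun u => t * u) t.
    by apply: (is_derive_eq (derM (derC c t) (derI c))); ring.
  apply: (is_derive_eq (derM (derC c t) (der_comp d1 dY))).
  by rewrite /h'; ring.
have ch' c : -1 <= c <= 1 -> {for c, continuous h'}.
  move=> /tb cb; have [_ [cY' _] _ _ _] := gs _ cb.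
  have c1 : {for c, continuous (fun u : R => t * u)}.
    by apply: (ctsM (f := fun=> t)); [exact: ctsC|exact: cts_id].
  have c2 := @continuous_comp _ _ _ (fun u : R => t * u) Y' c c1 cY'.
  exact: (cvgM (cvg_cst (t ^+ 2)) c2).
have gF2 := has_gradM gF gF.
have cDF2 : continuous (fun x => F x *: gradient F x + F x *: gradient F x).
  by apply: ctsDv; apply: ctsZv.
have div0 := divergence_radial pp gF2 cDF2 dh ch'.
pose q x := p - cosp p x *: x.
pose e x := h (cosp p x) * dot (F x *: gradient F x + F x *: gradient F x) (q x) +
  F x * F x * (h' (cosp p x) * (1 - cosp p x ^+ 2) - 2 * cosp p x * h (cosp p x)).
pose a x := dot (sphere_gradient F x) (sphere_gradient F x).
pose n x := F x ^+ 2 * N (t * cosp p x).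
have ch : continuous (fun x => h (cosp p x)).
  apply: cts_comp; first exact: continuous_cosp.
  move=> x; apply: differentiable_continuous; apply/derivable1_diffP.
  by case: (dh _ (cosp_bound x pp)).
have ch'c : continuous (fun x => h' (cosp p x)).
  apply: cts_comp; first exact: continuous_cosp.
  by move=> x; apply: ch'; exact: cosp_bound.
have cc := @continuous_cosp R p.
have ce : continuous e.
  have cq : continuous q.
    apply: ctsDv; first by move=> x; exact: cvg_cst.
    by move=> x; apply: cvgN; exact: (ctsZv cc (@cts_id _)).
  by rewrite /e; have := continuous_dot cDF2 cq => cdot; cts.
have ca : continuous a by apply: continuous_dot.
have cn : continuous n by apply: ctsM; [exact: ctsX|exact: (continuous_Ncosp pp gs t01)].
have int0 : (\int[sigma]_(x in sphere) (e x)%:E = 0)%E.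
  rewrite -[RHS]div0; apply: eq_integral => x /[!inE] Sx.
  by rewrite /e /q cosp_sphere.
have ii := @continuous_integrable_sphere R.
have -> : (\int[sigma]_(x in sphere) (F x ^+ 2 * N (t * dot x p))%:E =
    \int[sigma]_(x in sphere) ((n x)%:E + (e x)%:E))%E.
  rewrite integralD//=; [|exact: measurable_sphere|exact: ii|exact: ii].
  rewrite int0 adde0; apply: eq_integral => x /[!inE] Sx.
  by rewrite /n cosp_sphere.
have -> : (T C F (sphere_gradient F) =
    \int[sigma]_(x in sphere) ((a x)%:E + (C / 4 * F x ^+ 2)%:E))%E.
  have cF2 : continuous (fun x => F x ^+ 2) by exact: ctsX.
  rewrite integralD//=; [|exact: measurable_sphere|exact: ii|]; last first.
    by apply: ii; apply: ctsM; [exact: ctsC|].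
  rewrite /T /L2norm2_field /L2norm2; congr (_ + _)%E.
  under [RHS]eq_integral do rewrite EFinM.
  by rewrite integralZl//=; [exact: measurable_sphere|exact: ii].
apply: le_integral.
- exact: measurable_sphere.
- by apply: integrableD => //; [exact: measurable_sphere|exact: ii|exact: ii].
- apply: integrableD; [exact: measurable_sphere|exact: ii|apply: ii].
  by apply: ctsM; [exact: ctsC|exact: ctsX].
move=> x /[!inE] Sx; rewrite -!EFinD lee_fin.
have cb := dot_sphere_bound Sx pp; have [_ _ _ YY0 YY] := gs _ (tb _ cb).
rewrite /n /e /a /h /h' /q cosp_sphere//.
have -> : dot (F x *: gradient F x + F x *: gradient F x) (p - dot x p *: x) =
    2 * F x * dot (sphere_gradient F x) (p - dot x p *: x).
  have xq : dot x (p - dot x p *: x) = 0.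
    by move: Sx; rewrite /sphere /= => xx; rewrite dotC dotBl dotZl xx [dot p x]dotC; ring.
  move: (p - _) xq => w xw.
  by rewrite /sphere_gradient -scaleNr !dotDl !dotZl xw; ring.
have := dot_ge0 (sphere_gradient F x - (F x * (t * Y (t * dot x p))) *: (p - dot x p *: x)).
rewrite dot_sqrB [dot (sphere_gradient F x) (_ *: _)]dotC !dotZl.
rewrite [dot (p - _) (_ *: _)]dotC dotZl dot_tangent// [dot (p - _) (sphere_gradient F x)]dotC.
move: YY0 YY; set D := dot (sphere_gradient F x) (p - _);
set A := dot (sphere_gradient F x) (sphere_gradient F x); move: (dot x p) cb (F x) => c cb f.
move: (Y _) (Y' _) (N _) => y y' k y'0 YY sq.
have [t0 t1] := andP t01.
have f2 : 0 <= f ^+ 2 by exact: sqr_ge0.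
have key : f ^+ 2 * ((1 - c ^+ 2) * (t ^+ 2 * (y' + y ^+ 2)) - 2 * c * (t * y) + k - C / 4) <= 0.
  rewrite mulr_ge0_le0// subr_le0; apply: le_trans YY.
  rewrite lerD2r; have -> : 2 * (t * c) * y = 2 * c * (t * y) by ring.
  rewrite lerD2r; have -> : (1 - c ^+ 2) * (t ^+ 2 * (y' + y ^+ 2)) = (t ^+ 2 - (t * c) ^+ 2) * (y' + y ^+ 2) by ring.
  by rewrite ler_wpM2r// lerD2r expr_le1// ltW.
lra.
Qed.

End ground_state.

Section hardy_H1.
Context {R : realType}.
Implicit Types (F f : R3 R -> R) (g : R3 R -> R3 R) (x v p : R3 R) (c : R).
Local Notation sigma := (@surface_measure R).
Local Notation S h := (\int[sigma]_(x in sphere) (h x)%:E)%E.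

(** In this coordinatewise form, measurability passes to inner products and
    differences of vector fields. *)
Definition coord_measurable g := [/\ measurable_fun sphere (fun x => (g x).1.1),
  measurable_fun sphere (fun x => (g x).1.2) & measurable_fun sphere (fun x => (g x).2)].

Lemma measurable_coord g : measurable_fun sphere g -> coord_measurable g.
Proof.
move=> mg.
have m1 : measurable_fun sphere (fun x => (g x).1).
  exact: (measurableT_comp (f := fst) measurable_fst).
split.
- exact: (measurableT_comp (f := fst) measurable_fst m1).
- exact: (measurableT_comp (f := snd) measurable_snd m1).
- exact: (measurableT_comp (f := snd) measurable_snd mg).
Qed.

Lemma coord_measurable_dot g h : coord_measurable g -> coord_measurable h ->
  measurable_fun sphere (fun x => dot (g x) (h x)).
Proof.
move=> [g1 g2 g3] [h1 h2 h3]; rewrite /dot.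
by apply: measurable_funD; [apply: measurable_funD|]; exact: measurable_funM.
Qed.

Lemma coord_measurableB g h : coord_measurable g -> coord_measurable h ->
  coord_measurable (fun x => g x - h x).
Proof. by move=> [g1 g2 g3] [h1 h2 h3]; split; exact: measurable_funB. Qed.

Lemma continuous_coord_measurable g : continuous g -> coord_measurable g.
Proof. by move=> cg; split; apply: measurable_cts; cts. Qed.

Lemma continuous_measurable_field g : continuous g -> measurable_fun setT g.
Proof.
move=> cg; rewrite (_ : g = (fun x => ((g x).1.1, (g x).1.2, (g x).2))); last first.
  by apply/funext => x; case: (g x) => [[]].
by apply: measurable_fun_pair; [apply: measurable_fun_pair|];
  apply: continuous_measurable_fun3; cts.
Qed.

Lemma integral_le_lin (a b e : R3 R -> R) (k l : R) : 0 <= k -> 0 <= l ->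
  measurable_fun sphere a -> measurable_fun sphere b -> measurable_fun sphere e ->
  (forall x, sphere x -> 0 <= a x) -> (forall x, sphere x -> 0 <= b x) ->
  (forall x, sphere x -> 0 <= e x) ->
  (forall x, sphere x -> a x <= k * b x + l * e x) ->
  (S a <= k%:E * S b + l%:E * S e)%E.
Proof.
move=> k0 l0 ma mb me a0 b0 e0 ab; have mS := @measurable_sphere R.
rewrite -ge0_integralZl_EFin//; last exact/measurable_EFinP.
rewrite -[X in (_ + X)%E]ge0_integralZl_EFin//; last exact/measurable_EFinP.
rewrite -ge0_integralD//.
- apply: ge0_le_integral => //.
  + exact/measurable_EFinP.
  + by apply: emeasurable_funD; apply/measurable_EFinP; apply: measurable_funM.
- by move=> x Sx; rewrite mule_ge0// lee_fin// b0.
- by apply/measurable_EFinP; apply: measurable_funM.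
- by move=> x Sx; rewrite mule_ge0// lee_fin// e0.
- by apply/measurable_EFinP; apply: measurable_funM.
Qed.

Lemma T_integral C f g : 0 <= C -> measurable_fun sphere f -> coord_measurable g ->
  T C f g = S (fun x => dot (g x) (g x) + C / 4 * f x ^+ 2).
Proof.
move=> C0 mf mg; have mS := @measurable_sphere R.
have C4 : 0 <= C / 4 by rewrite divr_ge0.
under [RHS]eq_integral do rewrite EFinD EFinM.
rewrite ge0_integralD//.
- rewrite /T /L2norm2_field /L2norm2; congr (_ + _)%E.
  rewrite ge0_integralZl_EFin//; last by apply/measurable_EFinP; exact: measurable_funX.
  by move=> x _; rewrite lee_fin sqr_ge0.
- by move=> x _; rewrite lee_fin dot_ge0.
- by apply/measurable_EFinP; exact: coord_measurable_dot.
- by move=> x _; rewrite -EFinM lee_fin mulr_ge0// sqr_ge0.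
- by apply/measurable_EFinP; apply: measurable_funM => //; exact: measurable_funX.
Qed.

Lemma young (d a b : R) : 0 < d -> a ^+ 2 <= (1 + d) * b ^+ 2 + (1 + d^-1) * (a - b) ^+ 2.
Proof.
move=> d0; have := sqr_ge0 (d * b - (a - b)) => sq.
rewrite -subr_ge0; have -> : (1 + d) * b ^+ 2 + (1 + d^-1) * (a - b) ^+ 2 - a ^+ 2 =
  d^-1 * (d * b - (a - b)) ^+ 2 by field; rewrite gt_eqF.
by rewrite mulr_ge0// invr_ge0 ltW.
Qed.

Lemma young3 (d : R) x v : 0 < d ->
  dot x x <= (1 + d) * dot v v + (1 + d^-1) * dot (x - v) (x - v).
Proof.
move=> d0; have := young x.1.1 v.1.1 d0; have := young x.1.2 v.1.2 d0.
by have := young x.2 v.2 d0; rewrite /dot/=; lra.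
Qed.

Lemma le_of_sqr_factor (X : \bar R) (t : R) : 0 <= t ->
  (forall d, 0 < d -> (X <= ((1 + d) ^+ 2 * t)%:E)%E) -> (X <= t%:E)%E.
Proof.
move=> t0 Xt; apply/lee_addgt0Pr => e e0.
(* With d = e / (e + 3 t + 1) <= 1, ((1 + d)^2 - 1) t <= 3 d t <= e. *)
have D0 : 0 < e + 3 * t + 1 by lra.
have d0 : 0 < e / (e + 3 * t + 1) by rewrite divr_gt0.
apply: (le_trans (Xt _ d0)); rewrite -EFinD lee_fin.
have d1 : e / (e + 3 * t + 1) <= 1 by rewrite ler_pdivrMr//; lra.
have dt : 3 * t * (e / (e + 3 * t + 1)) <= e.
  by rewrite mulrA ler_pdivrMr//; nra.
by move: (e / _) d0 d1 dt => d d0 d1 dt; nra.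
Qed.

(** Density: N(t c) is bounded for t < 1, so both sides of the smooth inequality
    are continuous for the H^1 norm.  Young's inequality with a parameter d -> 0
    replaces the triangle inequality for the quadratic quantities. *)
Lemma ground_state_H1 C Y Y' N p t f g : sphere p -> 0 <= C ->
  ground_state C Y Y' N -> 0 <= t < 1 -> H1 (f, g) ->
  (S (fun x => f x ^+ 2 * N (t * dot x p)) <= T C f g)%E.
Proof.
move=> pp C0 gs t01 [/= mf fL mg gL [F [sF rF qF]]].
have mS := @measurable_sphere R.
have C4 : 0 <= C / 4 by rewrite divr_ge0.
pose n x := N (t * cosp p x).
have cn : continuous n := continuous_Ncosp pp gs t01.
have [M M0 nM] := bounded_on_sphere cn.
have n0 x : 0 <= n x by have [_ _] := gs _ (dilate_in_oo t01 (cosp_bound x pp)).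
have mn : measurable_fun sphere n by exact: measurable_cts.
have SE h : S (fun x => h x ^+ 2 * N (t * dot x p)) = S (fun x => h x ^+ 2 * n x).
  by apply: eq_integral => x /[!inE] Sx; rewrite /n cosp_sphere.
have T0 : (0 <= T C f g)%E.
  rewrite adde_ge0//; first by apply: integral_ge0 => x _; rewrite lee_fin dot_ge0.
  by rewrite mule_ge0//; apply: integral_ge0 => x _; rewrite lee_fin sqr_ge0.
have Tfin : T C f g \is a fin_num.
  rewrite ge0_fin_numE// /T; apply: lte_add_pinfty => //.
  by rewrite lte_mul_pinfty.
rewrite -(fineK Tfin) SE; apply: le_of_sqr_factor => [|d d0]; first by rewrite fine_ge0.
rewrite EFinM fineK//.
pose K := 1 + d^-1.
have K0 : 0 <= K by rewrite addr_ge0// invr_ge0 ltW.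
have d10 : 0 <= 1 + d by lra.
have vg := measurable_coord mg.
pose r k := L2norm2 (fun x => F k x - f x).
pose q k := L2norm2_field (fun x => sphere_gradient (F k) x - g x).
pose B k := (((1 + d) ^+ 2)%:E * T C f g + (((1 + d) * K)%:E *
  (q k + (C / 4)%:E * r k) + (K * M)%:E * r k))%E.
have cB : B k @[k --> \oo] --> (((1 + d) ^+ 2)%:E * T C f g)%E.
  rewrite -[X in _ --> X]adde0; apply: cvgeD => //.
  - by rewrite fin_num_adde_defl.
  - exact: cvg_cst.
  rewrite -[X in _ --> X]adde0; apply: cvgeD => //.
  - rewrite -[X in _ --> X](mule0 ((1 + d) * K)%:E); apply: cvgeZl => //.
    rewrite -[X in _ --> X]adde0; apply: cvgeD => //.
    by rewrite -[X in _ --> X](mule0 (C / 4)%:E); exact: cvgeZl.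
  - by rewrite -[X in _ --> X](mule0 (K * M)%:E); exact: cvgeZl.
apply: (cvge_to_ge cB); apply: nearW => k.
have cF := continuous_smooth (sF k); have csg := continuous_sphere_gradient (sF k).
have mF := measurable_cts cF; have vF := continuous_coord_measurable csg.
have mFf : measurable_fun sphere (fun x => F k x - f x) by exact: measurable_funB.
have KM0 : 0 <= K * M by rewrite mulr_ge0.
have step1 : (S (fun x => f x ^+ 2 * n x) <=
    (1 + d)%:E * S (fun x => F k x ^+ 2 * n x) + (K * M)%:E * r k)%E.
  apply: integral_le_lin => //.
  - by apply: measurable_funM => //; exact: measurable_funX.
  - by apply: measurable_funM => //; exact: measurable_funX.
  - exact: measurable_funX.
  - by move=> x _; rewrite mulr_ge0// sqr_ge0.
  - by move=> x _; rewrite mulr_ge0// sqr_ge0.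
  - by move=> x _; rewrite sqr_ge0.
  move=> x Sx; have := young (f x) (F k x) d0; rewrite -/K.
  have := nM _ Sx; rewrite ger0_norm//.
  rewrite -[(f x - F k x) ^+ 2]sqrrN opprB.
  move: (n0 x) (sqr_ge0 (F k x - f x)); move: (n x) ((F k x - f x) ^+ 2) (f x ^+ 2) (F k x ^+ 2).
  move=> nx e a b nx0 e0 nM' ab.
  have h1 : a * nx <= ((1 + d) * b + K * e) * nx by rewrite ler_wpM2r.
  have h2 : (K * e) * nx <= (K * e) * M by rewrite ler_wpM2l// mulr_ge0.
  lra.
have step2 : (S (fun x => F k x ^+ 2 * n x) <= T C (F k) (sphere_gradient (F k)))%E.
  by rewrite -SE; exact: (ground_state_smooth pp gs t01 (sF k)).
have step3 : (T C (F k) (sphere_gradient (F k)) <=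
    (1 + d)%:E * T C f g + K%:E * (q k + (C / 4)%:E * r k))%E.
  have -> : (q k + (C / 4)%:E * r k = T C (fun x => (F k x - f x)%R) (fun x => (sphere_gradient (F k) x - g x)%R))%E by [].
  rewrite !T_integral//; last exact: coord_measurableB.
  have mT (u : R3 R -> R) (v : R3 R -> R3 R) : measurable_fun sphere u -> coord_measurable v ->
      measurable_fun sphere (fun x => dot (v x) (v x) + C / 4 * u x ^+ 2).
    move=> mu mv; apply: measurable_funD; first exact: coord_measurable_dot.
    by apply: measurable_funM => //; exact: measurable_funX.
  have T0' (u : R3 R -> R) (v : R3 R -> R3 R) x : 0 <= dot (v x) (v x : R3 R) + C / 4 * u x ^+ 2.
    by rewrite addr_ge0// ?dot_ge0// mulr_ge0// sqr_ge0.
  apply: integral_le_lin => //.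
  - exact: (mT _ _ mF vF).
  - exact: (mT _ _ mf vg).
  - exact: (mT _ _ mFf (coord_measurableB vF vg)).
  - by move=> x _; exact: (T0' (fun x => F k x - f x) (fun x => sphere_gradient (F k) x - g x)).
  move=> x Sx; have := young (F k x) (f x) d0; have := young3 (sphere_gradient (F k) x) (g x) d0.
  rewrite -/K => h1 h2; have := ler_wpM2l C4 h2; lra.
apply: (le_trans step1); rewrite /B.
have r0 : (0 <= r k)%E by apply: integral_ge0 => x _; rewrite lee_fin sqr_ge0.
have q0 : (0 <= q k)%E by apply: integral_ge0 => x _; rewrite lee_fin dot_ge0.
rewrite addeA leeD2r//.
apply: (@le_trans _ _ ((1 + d)%:E * ((1 + d)%:E * T C f g + K%:E * (q k + (C / 4)%:E * r k)))%E).
  by rewrite lee_wpmul2l// (le_trans step2).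
have A1 : (0 <= (1 + d)%:E * T C f g)%E by rewrite mule_ge0.
have A2 : (0 <= K%:E * (q k + (C / 4)%:E * r k))%E.
  by apply: mule_ge0 => //; apply: adde_ge0 => //; exact: mule_ge0.
by rewrite (ge0_muleDr _ A1 A2) !muleA -!EFinM expr2.
Qed.

End hardy_H1.

Section hardy_fatou.
Context {R : realType}.
Local Notation sigma := (@surface_measure R).
Local Notation S h := (\int[sigma]_(x in sphere) (h x)%:E)%E.

(** Fatou's lemma for t = 1 - 1/(n+1) -> 1.  At the two poles N need not be
    continuous, so there W is compared with N(t c) for every t instead of with
    the limit. *)
Lemma hardy_H1 (C : R) (Y Y' N : R -> R) (W : R3 R -> R) (p : R3 R) f g :
  sphere p -> 0 <= C -> ground_state C Y Y' N -> H1 (f, g) ->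
  measurable_fun sphere W -> (forall x, sphere x -> 0 <= W x) ->
  (forall x, sphere x -> -1 < dot x p < 1 -> W x <= N (dot x p)) ->
  (forall x, sphere x -> `|dot x p| = 1 -> forall t, 0 <= t < 1 -> W x <= N (t * dot x p)) ->
  (S (fun x => f x ^+ 2 * W x) <= T C f g)%E.
Proof.
move=> pp C0 gs Hfg mW W0 Wint Wpole; have mS := @measurable_sphere R.
have [/= mf _ _ _ _] := Hfg.
pose t (n : nat) : R := 1 - n.+1%:R^-1.
have t01 n : 0 <= t n < 1.
  by rewrite subr_ge0 invf_le1// ler1n/= ltrBlDr ltrDl invr_gt0 ltr0n.
have ct : t n @[n --> \oo] --> (1 : R).
  rewrite -[X in _ --> X]subr0; apply: cvgB; first exact: cvg_cst.
  exact: cvg_harmonic.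
pose u n x := (f x ^+ 2 * N (t n * dot x p))%:E.
have mu n : measurable_fun sphere (u n).
  apply/measurable_EFinP; apply: measurable_funM; first exact: measurable_funX.
  apply: (eq_measurable_fun (fun x => N (t n * cosp p x))) => [x /[!inE] Sx|].
    by rewrite cosp_sphere.
  by apply: measurable_cts; exact: (continuous_Ncosp pp gs (t01 n)).
have N0 n x : sphere x -> 0 <= N (t n * dot x p).
  by move=> Sx; have [_ _] := gs _ (dilate_in_oo (t01 n) (dot_sphere_bound Sx pp)).
have u0 n x : sphere x -> (0 <= u n x)%E.
  by move=> Sx; rewrite lee_fin mulr_ge0 ?sqr_ge0// N0.
have := @fatou _ _ _ sigma _ mS u mu u0.
have lim_le : (limn_einf (fun n => \int[sigma]_(x in sphere) u n x) <= T C f g)%E.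
  rewrite limn_einf_lim; apply: lime_le; first exact: is_cvg_einfs.
  apply: nearW => n; apply: (@le_trans _ _ (\int[sigma]_(x in sphere) u n x)%E).
    by apply: ereal_inf_lbound; exists n => //=.
  exact: (ground_state_H1 pp C0 gs (t01 n) Hfg).
move=> /le_trans /(_ lim_le); apply: le_trans; apply: ge0_le_integral => //.
- by move=> x Sx; rewrite lee_fin mulr_ge0 ?sqr_ge0// W0.
- by apply/measurable_EFinP; apply: measurable_funM => //; exact: measurable_funX.
- rewrite (_ : (fun x => _) = (fun x => - limn_esup (fun n => - u n x))%E)//.
  apply: measurableT_comp => //; apply: measurable_fun_limn_esup => n.
  exact: measurableT_comp.
move=> x Sx; have cb := dot_sphere_bound Sx pp.
have [c1|c1] := pselect (`|dot x p| = 1).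
  rewrite limn_einf_lim; apply: lime_ge; first exact: is_cvg_einfs.
  apply: nearW => n; apply: le_ereal_inf_tmp => _ [k /= _ <-].
  by rewrite lee_fin ler_wpM2l ?sqr_ge0// Wpole.
have cb' : -1 < dot x p < 1.
  move: cb => /andP[ca cb]; rewrite !lt_neqAle ca cb !andbT.
  apply/andP; split; apply/eqP => e; apply: c1.
    by rewrite -e normrN1.
  by rewrite e normr1.
have -> : limn_einf (fun n => u n x) = (f x ^+ 2 * N (dot x p))%:E.
  apply: (cvg_limn_einf_sup _).1; apply: cvg_EFin; first exact: nearW.
  apply: cvgM; first exact: cvg_cst.
  have [_ [_ cN] _ _ _] := gs _ cb'.
  have ctp : t n * dot x p @[n --> \oo] --> dot x p.
    rewrite -[X in _ --> X]mul1r; apply: cvgM => //; exact: cvg_cst.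
  by apply: continuous_cvg; [exact: cN|exact: ctp].
by rewrite lee_fin ler_wpM2l ?sqr_ge0// Wint.
Qed.

End hardy_fatou.

(** * Numerical and trigonometric estimates *)

Section calculus.
Context {R : realType}.
Implicit Types (x y t u : R).

Lemma derive_ge0_le (f df : R -> R) a b : a <= b ->
  (forall x, a <= x <= b -> is_derive x (1 : R) f (df x)) ->
  (forall x, a < x < b -> 0 <= df x) -> f a <= f b.
Proof.
rewrite le_eqVlt => /predU1P[->//|ab] dF df0.
have cf : {within `[a, b], continuous f}.
  apply: derivable_within_continuous => x; rewrite in_itv/= => xab.
  by case: (dF x xab).
have dF' x : x \in `]a, b[ -> is_derive x (1 : R) f (df x).
  by rewrite in_itv/= => /andP[ax xb]; apply: dF; rewrite !ltW.
have [c] := MVT ab dF' cf; rewrite in_itv/= => cab e.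
by rewrite -subr_ge0 e mulr_ge0 ?df0// subr_ge0 ltW.
Qed.

Lemma sin_le x : 0 <= x -> sin x <= x.
Proof.
move=> x0; rewrite -subr_ge0.
have -> : 0 = 0 - sin 0 :> R by rewrite sin0 subr0.
have d (u : R) : is_derive u (1 : R) (fun u => u - sin u) (1 - cos u).
  exact: (derD (derI u) (derN (is_derive_sin u))).
apply: (derive_ge0_le x0 (fun u _ => d u)) => u _.
by rewrite subr_ge0 cos_le1.
Qed.

Lemma cos_ge x : 0 <= x -> 1 - x ^+ 2 / 2 <= cos x.
Proof.
move=> x0; rewrite -subr_ge0.
have -> : 0 = cos 0 - (1 - 0 ^+ 2 / 2) :> R by rewrite cos0; field.
have d (u : R) : is_derive u (1 : R) (fun u => cos u - (1 - u ^+ 2 / 2)) (u - sin u).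
  apply: (is_derive_eq (derD (is_derive_cos u) (derN (derD (derC u 1)
    (derN (derM (derM (derI u) (derI u)) (derC u 2^-1))))))).
  by field.
apply: (derive_ge0_le x0 (fun u _ => d u)) => u /andP[u0 _].
by rewrite subr_ge0 sin_le// ltW.
Qed.

Lemma sin_ge x : 0 <= x -> x - x ^+ 3 / 6 <= sin x.
Proof.
move=> x0; rewrite -subr_ge0.
have -> : 0 = sin 0 - (0 - 0 ^+ 3 / 6) :> R by rewrite sin0; field.
have d (u : R) : is_derive u (1 : R) (fun u => sin u - (u - u ^+ 3 / 6))
    (cos u - (1 - u ^+ 2 / 2)).
  apply: (is_derive_eq (derD (is_derive_sin u) (derN (derD (derI u)
    (derN (derM (derM (derI u) (derM (derI u) (derI u))) (derC u 6^-1))))))).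
  by field.
apply: (derive_ge0_le x0 (fun u _ => d u)) => u /andP[u0 _].
by rewrite subr_ge0 cos_ge// ltW.
Qed.

Lemma mulcos_le_sin x : 0 <= x <= pi -> x * cos x <= sin x.
Proof.
move=> /andP[x0 xpi]; rewrite -subr_ge0.
have -> : 0 = sin 0 - 0 * cos 0 :> R by rewrite sin0; field.
have d (u : R) : is_derive u (1 : R) (fun u => sin u - u * cos u) (u * sin u).
  apply: (is_derive_eq (derD (is_derive_sin u) (derN (derM (derI u) (is_derive_cos u))))).
  by ring.
apply: (derive_ge0_le x0 (fun u _ => d u)) => u /andP[u0 ux].
rewrite mulr_ge0 ?(ltW u0)//.
by rewrite sin_ge0_pi// (ltW u0)/= (le_trans (ltW ux)).
Qed.

Lemma sin_pi6 : sin (pi / 6) = 2^-1 :> R.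
Proof.
have : sin (pi / 2) = 1 :> R by exact: sin_pihalf.
have -> : pi / 2 = pi / 6 + (pi / 6) *+ 2 :> R by rewrite -mulr_natr; field.
rewrite sinD sin_mulr2n cos_mulr2n.
have := cos2Dsin2 (pi / 6 : R).
have s0 : 0 <= sin (pi / 6) :> R.
  have := @pi_gt0 R => pi0; apply: sin_ge0_pi; apply/andP; split; lra.
move: (sin _) (cos _) s0 => s c s0 e1 e2.
have : (s + 1) * (2 * s - 1) ^+ 2 = 0.
  have -> : (s + 1) * (2 * s - 1) ^+ 2 = 1 -
      (s * (c ^+ 2 + c ^+ 2 - 1) + c * (c * s + c * s)) + (c ^+ 2 + s ^+ 2 - 1) * (4 * s).
    by ring.
  by rewrite -!mulr2n e1 e2 !subrr mul0r addr0.
move/eqP; rewrite mulf_eq0 sqrf_eq0 => /orP[|] /eqP h; lra.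
Qed.

Lemma pi_ge3 : 3 <= pi :> R.
Proof. have := @pi_gt0 R => p0; have := @sin_le (pi / 6); rewrite sin_pi6; lra. Qed.

(** sin(pi/6) = 1/2 and sin y >= y - y^3/6; the latter is increasing on [0, 2/3],
    which contains pi/6. *)
Lemma pi_le315 : pi <= 3 + 3 / 20 :> R.
Proof.
have pi0 := @pi_gt0 R; have pi4 : pi / 2 < 2 :> R := @pihalf_lt2 R.
have y0 : 0 <= pi / 6 :> R by lra.
have := sin_ge y0; rewrite sin_pi6; set y := pi / 6 => h.
have y1 : y <= 2 / 3 by rewrite /y; lra.
have -> : pi = 6 * y by rewrite /y; field.
rewrite leNgt; apply/negP => yy.
have {}yy : 21 / 40 < y by lra.
have y2 : y ^+ 2 <= 4 / 9 by nra.
have : 0 <= (y - 21 / 40) * (1 - (y ^+ 2 + y * (21 / 40) + (21 / 40) ^+ 2) / 6).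
  by apply: mulr_ge0; lra.
lra.
Qed.

(** A lower bound with an error of third order, so that few factors are needed
    in ln_ge_pow. *)
Lemma ln1D_ge t : 0 <= t -> 2 * t / (2 + t) <= ln (1 + t).
Proof.
move=> t0; rewrite -subr_ge0.
have -> : 0 = ln (1 + 0) - 2 * 0 / (2 + 0) :> R by rewrite addr0 ln1; field.
have d (u : R) : 0 <= u <= t -> is_derive u (1 : R) (fun u => ln (1 + u) - 2 * u / (2 + u))
    (u ^+ 2 / ((1 + u) * (2 + u) ^+ 2)).
  move=> /andP[u0 _]; have u1 : 0 < 1 + u by lra.
  have u2 : 2 + u != 0 by rewrite gt_eqF//; lra.
  apply: (is_derive_eq (derD (der_ln (f := fun v => 1 + v) u1 (derD (derC u 1) (derI u)))
    (derN (derM (derM (derC u 2) (derI u)) (derV u2 (derD (derC u 2) (derI u))))))).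
  by field; rewrite u2 gt_eqF.
apply: (derive_ge0_le t0 d) => u /andP[u0 _].
by rewrite divr_ge0 ?sqr_ge0// mulr_ge0 ?sqr_ge0//; lra.
Qed.

Lemma ln_ge_pow n x t : 0 <= t -> (1 + t) ^+ n <= x -> 2 * t / (2 + t) *+ n <= ln x.
Proof.
move=> t0 tx; have t1 : 0 < 1 + t by lra.
have := ln1D_ge t0; move/(ler_wMn2r n) => /le_trans; apply.
by rewrite -lnXn// ler_ln// posrE; [exact: exprn_gt0|exact: (lt_le_trans (exprn_gt0 n t1))].
Qed.

Lemma ln_le_pow n x t : 0 < x -> 0 <= t -> x <= (1 + t) ^+ n -> ln x <= t *+ n.
Proof.
move=> x0 t0 xt; have t1 : 0 < 1 + t by lra.
have : ln x <= ln ((1 + t) ^+ n) by rewrite ler_ln ?posrE// exprn_gt0.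
move=> /le_trans; apply; rewrite lnXn//; apply: ler_wMn2r.
by apply: le_ln1Dx; lra.
Qed.

(** Large powers are evaluated by repeated squaring, rounding to a short decimal
    at each step so that the rationals stay small. *)
Lemma sqr_ge_trans (a b y : R) : 0 <= a -> b <= a ^+ 2 -> a <= y -> b <= y ^+ 2.
Proof. by move=> a0 ba ay; nra. Qed.

Lemma sqr_le_trans (a b y : R) : 0 <= y -> a ^+ 2 <= b -> y <= a -> y ^+ 2 <= b.
Proof. by move=> a0 ba ay; nra. Qed.

Lemma ln_ge_pow10 x t : 0 <= t ->
  (((1 + t) ^+ 2) ^+ 2) ^+ 2 * (1 + t) ^+ 2 <= x -> 20 * t / (2 + t) <= ln x.
Proof.
rewrite -!exprM -exprD => t0 /(ln_ge_pow t0); rewrite -mulr_natl.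
by rewrite mulrA mulrA -natrM.
Qed.

Lemma ln3_ge : 1096 / 1000 <= ln 3 :> R.
Proof.
apply: (@le_trans _ _ (20 * (29 / 250) / (2 + 29 / 250))); first by rewrite ler_pdivlMr; lra.
apply: ln_ge_pow10; first lra.
have h2 : (1 + 29 / 250) ^+ 2 <= (12 * 1000 + 455) / (10 * 1000) :> R by lra.
have h20 : 0 <= (1 + 29 / 250) ^+ 2 :> R by exact: sqr_ge0.
move: ((1 + 29 / 250) ^+ 2) h2 h20 => y h2 h20.
have h4 : y ^+ 2 <= (15 * 1000 + 513) / (10 * 1000) by apply: (sqr_le_trans h20 _ h2); lra.
have h8 : (y ^+ 2) ^+ 2 <= (24 * 1000 + 66) / (10 * 1000) by apply: (sqr_le_trans (sqr_ge0 y) _ h4); lra.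
have := ler_pM (sqr_ge0 (y ^+ 2)) h20 h8 h2.
by move=> /le_trans; apply; lra.
Qed.

Lemma lnpi_ge : 1096 / 1000 <= ln pi :> R.
Proof.
apply: le_trans ln3_ge _; have := pi_ge3 => h.
by rewrite ler_ln// posrE; lra.
Qed.

Lemma ln_le_pow64 x t : 0 < x -> 0 <= t ->
  x <= ((((((1 + t) ^+ 2) ^+ 2) ^+ 2) ^+ 2) ^+ 2) ^+ 2 -> ln x <= 64 * t.
Proof.
by rewrite -!exprM mulr_natl => x0 t0 h; exact: (@ln_le_pow 64 x t x0 t0 h).
Qed.

Lemma lnpi_le : ln pi <= 116 / 100 :> R.
Proof.
have -> : 116 / 100 = 64 * (29 / 1600) :> R by field.
apply: ln_le_pow64; [exact: pi_gt0|lra|].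
apply: le_trans pi_le315 _.
apply: (@sqr_ge_trans ((17 * 1000 + 764) / (10 * 1000))); [lra|lra|].
apply: (@sqr_ge_trans ((133 * 1000 + 282) / (100 * 1000))); [lra|lra|].
apply: (@sqr_ge_trans ((115 * 1000 + 448) / (100 * 1000))); [lra|lra|].
apply: (@sqr_ge_trans ((107 * 1000 + 447) / (100 * 1000))); [lra|lra|].
apply: (@sqr_ge_trans ((103 * 1000 + 657) / (100 * 1000))); [lra|lra|].
lra.
Qed.

Lemma ln2_le : ln 2 <= 7 / 10 :> R.
Proof.
have -> : 7 / 10 = 64 * (7 / 640) :> R by field.
apply: ln_le_pow64; [lra|lra|].
apply: (@sqr_ge_trans ((141 * 1000 + 619) / (100 * 1000))); [lra|lra|].
apply: (@sqr_ge_trans ((119 * 1000 + 4) / (100 * 1000))); [lra|lra|].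
apply: (@sqr_ge_trans ((109 * 1000 + 89) / (100 * 1000))); [lra|lra|].
apply: (@sqr_ge_trans ((104 * 1000 + 446) / (100 * 1000))); [lra|lra|].
apply: (@sqr_ge_trans ((102 * 1000 + 199) / (100 * 1000))); [lra|lra|].
lra.
Qed.

Lemma ln2_ge0 : 0 <= ln 2 :> R.
Proof. by rewrite ln_ge0// ler1n. Qed.

End calculus.

(** * The ground state for phi *)

Section two_pole_ground_state.
Context {R : realType}.
Implicit Types (k s c r : R).

(** With k = kphi and s half the squared chord this is 2 phi of the chord; with
    k = kpsi and s = sin d ^+ 2 it is 2 psi d. *)
Definition ellp k s := k - ln s.
Definition pole_weight k s := (2 * s * ellp k s ^+ 2)^-1.

(** The logarithmic derivative of u = sqrt (ellp k (1 - c) * ellp k (1 + c)). *)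
Definition poleY k c := 2^-1 * (((1 - c) * ellp k (1 - c))^-1 - ((1 + c) * ellp k (1 + c))^-1).
Definition poleY' k c := 2^-1 *
  ((ellp k (1 - c) - 1) / ((1 - c) * ellp k (1 - c)) ^+ 2 +
   (ellp k (1 + c) - 1) / ((1 + c) * ellp k (1 + c)) ^+ 2).
Definition poleN k c := pole_weight k (1 - c) + pole_weight k (1 + c).

Lemma ellp_ge k s : 0 < s <= 2 -> k - ln 2 <= ellp k s.
Proof. by move=> /andP[s0 s2]; rewrite /ellp lerD2l lerN2 ler_ln// posrE. Qed.

Lemma der_ellp k (f : R -> R) c a : 0 < f c -> is_derive c (1 : R) f a ->
  is_derive c (1 : R) (fun u => ellp k (f u)) (- (a / f c)).
Proof.
move=> f0 df; apply: (is_derive_eq (derD (derC c k) (derN (der_ln f0 df)))).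
by rewrite add0r.
Qed.

Lemma der_poleY k c : 2 <= k - ln 2 -> -1 < c < 1 -> is_derive c (1 : R) (poleY k) (poleY' k c).
Proof.
move=> k2 /andP[c0 c1].
have s0 : 0 < 1 - c by lra.
have t0 : 0 < 1 + c by lra.
have l0 : 2 <= ellp k (1 - c) by apply: le_trans k2 (ellp_ge _ _); lra.
have m0 : 2 <= ellp k (1 + c) by apply: le_trans k2 (ellp_ge _ _); lra.
have ds := derD (derC c 1) (derN (derI c)); have dt := derD (derC c 1) (derI c).
have sl0 : (1 - c) * ellp k (1 - c) != 0 by rewrite mulf_neq0// gt_eqF//; lra.
have tm0 : (1 + c) * ellp k (1 + c) != 0 by rewrite mulf_neq0// gt_eqF//; lra.
have dl := derV (f := fun u => (1 - u) * ellp k (1 - u)) sl0 (derM ds (der_ellp k (f := fun u => 1 - u) s0 ds)).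
have dm := derV (f := fun u => (1 + u) * ellp k (1 + u)) tm0 (derM dt (der_ellp k (f := fun u => 1 + u) t0 dt)).
apply: (is_derive_eq (derM (derC c 2^-1) (derD dl (derN dm)))).
rewrite /poleY'; move: (ellp _ _) (ellp _ _) l0 m0 => l m l0 m0.
by field; rewrite !gt_eqF//; lra.
Qed.

(** For u = sqrt (l m), the singular terms of the Riccati expression are exactly
    minus the two pole weights; what remains is bounded. *)
Lemma pole_riccati (s t l m : R) : s != 0 -> t != 0 -> l != 0 -> m != 0 -> t = 2 - s ->
  let c := 1 - s in
  let y := 2^-1 * ((s * l)^-1 - (t * m)^-1) in
  let y' := 2^-1 * ((l - 1) / (s * l) ^+ 2 + (m - 1) / (t * m) ^+ 2) in
  (1 - c ^+ 2) * (y' + y ^+ 2) - 2 * c * y + ((2 * s * l ^+ 2)^-1 + (2 * t * m ^+ 2)^-1) =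
  (l^-1 + m^-1) / 2 + (l^-1 - m^-1) ^+ 2 / 4.
Proof.
move=> s0 t0 l0 m0 tE /=; move: t0; rewrite tE => t0.
by field; rewrite s0 t0 l0 m0.
Qed.

Lemma continuous_poleY' k c : 2 <= k - ln 2 -> -1 < c < 1 ->
  {for c, continuous (poleY' k)} /\ {for c, continuous (poleN k)}.
Proof.
move=> k2 /andP[c0 c1].
have s0 : 0 < 1 - c by lra.
have t0 : 0 < 1 + c by lra.
have l0 : 2 <= ellp k (1 - c) by apply: le_trans k2 (ellp_ge _ _); lra.
have m0 : 2 <= ellp k (1 + c) by apply: le_trans k2 (ellp_ge _ _); lra.
have cl : {for c, continuous (fun u : R => ellp k (1 - u))} by rewrite /ellp; cf.
have cm : {for c, continuous (fun u : R => ellp k (1 + u))} by rewrite /ellp; cf.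
split; rewrite /poleY' /poleN /pole_weight; cf; rewrite ?expf_neq0 ?mulf_neq0 ?expf_neq0 ?gt_eqF//; lra.
Qed.

(** Both sides agree to first order at r = 0, and the derivative of their difference
    has the sign of r, because k^2 - 2 k >= 3 > r. *)
Lemma ln_le_homographic k r : 3 <= k -> -1 < r <= 1 -> ln (1 + r) <= k * r / (k + r).
Proof.
move=> k3 /andP[r0 r1]; rewrite -subr_ge0.
pose f (u : R) := k * u / (k + u) - ln (1 + u).
pose df (u : R) := u * (k ^+ 2 - 2 * k - u) / ((k + u) ^+ 2 * (1 + u)).
have d (u : R) : -1 < u <= 1 -> is_derive u (1 : R) f (df u).
  move=> /andP[u0 u1]; have u1' : 0 < 1 + u by lra.
  have ku : k + u != 0 by rewrite gt_eqF//; lra.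
  apply: (is_derive_eq (derD (derM (derM (derC u k) (derI u)) (derV ku (derD (derC u k) (derI u))))
    (derN (der_ln (f := fun v => 1 + v) u1' (derD (derC u 1) (derI u)))))).
  by rewrite /df; field; rewrite ku gt_eqF.
have f0 : f 0 = 0 by rewrite /f !addr0 ln1 mulr0 mul0r subr0.
rewrite -/(f r) -f0; have [rp|rn] := leP 0 r.
  apply: (@derive_ge0_le _ f df 0 r rp) => [u /andP[u0 u1]|u /andP[u0 u1]].
    by apply: d; apply/andP; split; lra.
  by rewrite /df divr_ge0// ?mulr_ge0 ?sqr_ge0//; nra.
rewrite -lerN2; apply: (@derive_ge0_le _ (fun u => - f u) (fun u => - df u) r 0 (ltW rn)).
  by move=> u /andP[u0 u1]; apply: derN; apply: d; apply/andP; split; lra.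
move=> u /andP[u0 u1]; rewrite /df oppr_ge0 mulr_le0_ge0//.
  by rewrite mulr_le0_ge0//; nra.
by rewrite invr_ge0 mulr_ge0 ?sqr_ge0//; lra.
Qed.

(** The tangent line at s = 1 of s |-> 1 / (k - ln s), which is concave as long as
    k - ln s >= 2; taking inverses, this is ln_le_homographic. *)
Lemma inv_ellp_le k s : 3 <= k -> 0 < s <= 2 -> 0 < ellp k s ->
  (ellp k s)^-1 <= (k + (s - 1)) / k ^+ 2.
Proof.
move=> k3 /andP[s0 s2] l0.
have h : ln s <= k * (s - 1) / (k + (s - 1)).
  have -> : ln s = ln (1 + (s - 1)) by congr ln; ring.
  by apply: ln_le_homographic => //; apply/andP; split; lra.
have ks : 0 < k + (s - 1) by lra.
have k0 : 0 < k ^+ 2 by rewrite exprn_gt0//; lra.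
rewrite -[X in _ <= X]invrK lef_pV2 ?posrE ?invr_gt0 ?divr_gt0//.
rewrite invf_div /ellp; apply: le_trans (lerB (lexx k) h).
by rewrite le_eqVlt; apply/orP; left; apply/eqP; field; rewrite gt_eqF.
Qed.

End two_pole_ground_state.

Section ground_states.
Context {R : realType}.
Implicit Types (k s c r t : R).

Definition lpi1 : R := 1 + ln pi.

Lemma lpi1_bounds : 419 / 200 <= lpi1 <= 54 / 25.
Proof. by rewrite /lpi1; have := @lnpi_ge R; have := @lnpi_le R => ? ?; apply/andP; split; lra. Qed.

Lemma pi2_le10 : pi ^+ 2 <= 10 :> R.
Proof. have := @pi_le315 R; have := @pi_ge3 R => *; nra. Qed.

Lemma constA_ge : 6 / 5 <= constA :> R.
Proof.
rewrite /constA; have /andP[X1 X2] := lpi1_bounds; rewrite -/lpi1.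
have p0 : 0 < pi ^+ 2 :> R by rewrite exprn_gt0// pi_gt0.
have := pi2_le10; have := @ln2_le R; have := @ln2_ge0 R => l0 l2 p2.
have h1 : 2 / (54 / 25) <= 2 / lpi1 by rewrite ler_pM2l// lef_pV2 ?posrE; lra.
have l1 : 0 < 1 + ln 2 :> R by lra.
have D0 : 0 < pi ^+ 2 * (1 + ln 2) ^+ 2 :> R by rewrite mulr_gt0// exprn_gt0.
have D1 : pi ^+ 2 * (1 + ln 2) ^+ 2 <= 10 * (289 / 100) :> R by rewrite ler_pM ?sqr_ge0//; nra.
have h2 : 8 / (10 * (289 / 100)) <= 8 / (pi ^+ 2 * (1 + ln 2) ^+ 2) :> R.
  by rewrite ler_pM2l// lef_pV2 ?posrE; lra.
have e1 : 2 / (54 / 25) = 25 / 27 :> R by field.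
have e2 : 8 / (10 * (289 / 100)) = 80 / 289 :> R by field.
rewrite e1 in h1; rewrite e2 in h2; lra.
Qed.

(** Chosen so that phi (sqrt (2 s)) = ellp kphi s / 2. *)
Definition kphi : R := 2 * lpi1 - ln 2.

Lemma kphi_ge : 349 / 100 <= kphi.
Proof.
by rewrite /kphi; have /andP[X1 X2] := lpi1_bounds; have := @ln2_le R; lra.
Qed.

Lemma ellp_kphi_ge s : 0 < s <= 2 -> 279 / 100 <= ellp kphi s.
Proof.
move=> s02; apply: le_trans (ellp_ge _ s02); have := kphi_ge; have := @ln2_le R; lra.
Qed.

(** Bounding (a - b)^2 by 359/1000 |a - b| makes the claim linear in a and b.  It is
    used with a and b the values of 1 / ellp kphi, which are at most 359/1000 and
    whose mean is at most 1 / kphi <= 287/1000. *)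
Lemma two_pole_energy_le (a b : R) : 0 <= a <= 359 / 1000 -> 0 <= b <= 359 / 1000 ->
  a + b <= 2 * (287 / 1000) -> (a + b) / 2 + (a - b) ^+ 2 / 4 <= 3 / 10.
Proof.
wlog le_ab : a b / a <= b.
  move=> H a0 b0 ab; have [h|/ltW h] := leP a b; first exact: H.
  have -> : (a + b) / 2 + (a - b) ^+ 2 / 4 = (b + a) / 2 + (b - a) ^+ 2 / 4 by ring.
  by apply: H => //; rewrite addrC.
move=> /andP[a0 a1] /andP[b0 b1] ab.
have d2 : (a - b) ^+ 2 <= 359 / 1000 * (b - a) by nra.
lra.
Qed.

(** Adding the tangent lines at s = 1 for s = 1 - c and s = 1 + c, the linear terms
    cancel. *)
Lemma two_pole_inv_sum_le c : -1 < c < 1 ->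
  (ellp kphi (1 - c))^-1 + (ellp kphi (1 + c))^-1 <= 2 / kphi.
Proof.
move=> /andP[c0 c1]; have k0 := kphi_ge.
have k3 : 3 <= kphi by lra.
have pos s : 0 < s <= 2 -> 0 < ellp kphi s by move/ellp_kphi_ge; lra.
have ks : 0 < 1 - c <= 2 by apply/andP; split; lra.
have kt : 0 < 1 + c <= 2 by apply/andP; split; lra.
apply: le_trans (lerD (inv_ellp_le k3 ks (pos _ ks)) (inv_ellp_le k3 kt (pos _ kt))) _.
have kn0 : kphi != 0 by rewrite gt_eqF//; lra.
by rewrite le_eqVlt; apply/orP; left; apply/eqP; field.
Qed.

Lemma inv_le_bound (l b : R) : 0 < l -> 1 <= b * l -> 0 <= l^-1 <= b.
Proof.
by move=> l0 h; rewrite invr_ge0 (ltW l0)/= -div1r ler_pdivrMr.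
Qed.

Lemma ground_state_phi :
  ground_state constA (poleY kphi) (poleY' kphi) (poleN kphi).
Proof.
have k2 : 2 <= kphi - ln 2 by have := kphi_ge; have := @ln2_le R; lra.
move=> c cb.
have ks : 0 < 1 - c <= 2 by move: cb => /andP[c0 c1]; apply/andP; split; lra.
have kt : 0 < 1 + c <= 2 by move: cb => /andP[c0 c1]; apply/andP; split; lra.
have := two_pole_inv_sum_le cb.
have := ellp_kphi_ge ks; have := ellp_kphi_ge kt.
have := @pole_riccati R (1 - c) (1 + c) (ellp kphi (1 - c)) (ellp kphi (1 + c)).
have e : 1 - (1 - c) = c by ring.
have e' : 1 + c = 2 - (1 - c) by ring.
rewrite e /= -/(poleY kphi c) -/(poleY' kphi c) => ric m0 l0 lm.
have [s0 t0] : 0 < 1 - c /\ 0 < 1 + c by move: ks kt => /andP[-> _] /andP[-> _].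
have lpos : 0 < ellp kphi (1 - c) by apply: lt_le_trans l0; lra.
have mpos : 0 < ellp kphi (1 + c) by apply: lt_le_trans m0; lra.
split.
- exact: der_poleY.
- exact: continuous_poleY'.
- by rewrite /poleN /pole_weight addr_ge0// invr_ge0 mulr_ge0 ?sqr_ge0// mulr_ge0// ltW.
- rewrite addr_ge0 ?sqr_ge0// /poleY' mulr_ge0// addr_ge0// divr_ge0 ?sqr_ge0//.
    by rewrite subr_ge0; apply: le_trans l0; lra.
  by rewrite subr_ge0; apply: le_trans m0; lra.
rewrite /poleN /pole_weight ric ?gt_eqF//.
apply: (@le_trans _ _ (3 / 10)); last by have := constA_ge; lra.
apply: two_pole_energy_le; first by apply: inv_le_bound => //; lra.
  by apply: inv_le_bound => //; lra.
apply: le_trans lm _; have k0 := kphi_ge.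
by rewrite ler_pdivrMr; lra.
Qed.

End ground_states.

(** * The ground state for psi *)

Section ground_state_psi.
Context {R : realType}.
Implicit Types (c : R).

(** Chosen so that psi d = ellp kpsi (sin d ^+ 2) / 2. *)
Definition kpsi : R := 2 * lpi1.

(** At the equator sqrt (psiL) alone gives 1/k + 1/k^2 with k = kpsi, slightly more
    than constB / 4 = 1/k + (8/pi^2)/k^2.  The factor exp (- kap c^2 / 2) lowers
    the value there by kap, at a price that is affordable near the poles, where
    1 / psiL is smaller. *)
Definition kap : R := 7 / 500.
Definition psiL c := ellp kpsi (1 - c ^+ 2).

(** The logarithmic derivative of u = sqrt (psiL c) * exp (- kap c^2 / 2). *)
Definition psiY c := c * (((1 - c ^+ 2) * psiL c)^-1 - kap).
Definition psiY' c := (((1 - c ^+ 2) * psiL c)^-1 - kap) +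
  2 * c ^+ 2 * (psiL c - 1) / ((1 - c ^+ 2) * psiL c) ^+ 2.
Definition psiN c := ((1 - c ^+ 2) * psiL c ^+ 2)^-1.

Lemma kpsi_bounds : 419 / 100 <= kpsi <= 108 / 25.
Proof.
by rewrite /kpsi; have /andP[X1 X2] := @lpi1_bounds R; apply/andP; split; lra.
Qed.

Lemma sub1_sqr_gt0 c : -1 < c < 1 -> 0 < 1 - c ^+ 2.
Proof. by move=> /andP[c0 c1]; nra. Qed.

Lemma psiL_ge c : -1 < c < 1 -> kpsi + c ^+ 2 <= psiL c.
Proof.
move=> /sub1_sqr_gt0 w0; rewrite /psiL /ellp.
have : ln (1 + - c ^+ 2) <= - c ^+ 2 by apply: le_ln1Dx; lra.
lra.
Qed.

Lemma psiL_ge4 c : -1 < c < 1 -> 4 <= psiL c.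
Proof.
move/psiL_ge; have := sqr_ge0 c; have /andP[k0 _] := kpsi_bounds; lra.
Qed.

Lemma der_psiY c : -1 < c < 1 -> is_derive c (1 : R) psiY (psiY' c).
Proof.
move=> cb; have w0 := sub1_sqr_gt0 cb; have l4 := psiL_ge4 cb.
have dw : is_derive c (1 : R) (fun u : R => 1 - u ^+ 2) (- 2 * c).
  apply: (is_derive_eq (derD (derC c 1) (derN (derM (derI c) (derI c))))).
  by ring.
have dl := der_ellp kpsi (f := fun u => 1 - u ^+ 2) w0 dw.
have D0 : (1 - c ^+ 2) * psiL c != 0 by rewrite mulf_neq0// gt_eqF//; lra.
have dD := derV (f := fun u => (1 - u ^+ 2) * psiL u) D0 (derM dw dl).
apply: (is_derive_eq (derM (derI c) (derD dD (derC c (- kap))))).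
rewrite /psiY' -/(psiL c); move: (psiL c) kap l4 => l k l4.
by field; rewrite !gt_eqF//; lra.
Qed.

Lemma psi_riccati (w l k c : R) : l != 0 -> w != 0 -> c ^+ 2 = 1 - w ->
  let y := c * ((w * l)^-1 - k) in
  let y' := ((w * l)^-1 - k) + 2 * c ^+ 2 * (l - 1) / (w * l) ^+ 2 in
  w * (y' + y ^+ 2) - 2 * c * y + (w * l ^+ 2)^-1 =
  l^-1 + l^-1 ^+ 2 + k * (3 * c ^+ 2 - 1) - 2 * k * c ^+ 2 / l + k ^+ 2 * c ^+ 2 * w.
Proof.
move=> l0 w0 cE /=.
rewrite [(c * _) ^+ 2]exprMn; have -> : 2 * c * (c * ((w * l)^-1 - k)) = 2 * c ^+ 2 * ((w * l)^-1 - k) by ring.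
by rewrite cE; field; rewrite l0 w0.
Qed.

(** The loss of 1 / psiL away from the equator pays for the correction kap; 43/1000 is
    a lower bound of 1 / (k (k + 1)) for k = kpsi. *)
Lemma inv_psiL_le c : -1 < c < 1 -> (psiL c)^-1 <= kpsi^-1 - 43 / 1000 * c ^+ 2.
Proof.
move=> cb; have l0 := psiL_ge cb; have /andP[k0 k1] := kpsi_bounds.
have u0 := sqr_ge0 c; have w0 := sub1_sqr_gt0 cb.
have kp : 0 < kpsi by lra.
apply: (@le_trans _ _ ((kpsi + c ^+ 2)^-1)).
  by rewrite lef_pV2// posrE; lra.
move: (c ^+ 2) u0 w0 l0 => u u0 w0 l0; move: kpsi kp k0 k1 l0 => k kp k0 k1 l0.
have -> : (k + u)^-1 = k^-1 - u * (k * (k + u))^-1 by field; rewrite !gt_eqF//; lra.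
rewrite lerD2l lerN2 [leRHS]mulrC ler_wpM2r//.
have ku0 : 0 < k * (k + u) by rewrite mulr_gt0//; lra.
rewrite -[leRHS]div1r ler_pdivlMr; last exact: ku0.
have : k * (k + u) <= 108 / 25 * (133 / 25) by apply: ler_pM; lra.
lra.
Qed.

Lemma constB_ge : kpsi^-1 + 4 / 5 * kpsi^-1 ^+ 2 <= constB / 4 :> R.
Proof.
have /andP[k0 k1] := kpsi_bounds.
have X0 : 0 < lpi1 :> R by move: k0; rewrite /kpsi; lra.
rewrite /constB -/lpi1 /kpsi.
have p0 : 0 < pi ^+ 2 :> R by rewrite exprn_gt0// pi_gt0.
have -> : (2 / lpi1 + 8 / (pi ^+ 2 * lpi1 ^+ 2)) / 4 =
  (2 * lpi1)^-1 + 8 / pi ^+ 2 * (2 * lpi1)^-1 ^+ 2 :> R.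
  move: (pi ^+ 2) lpi1 p0 X0 => P X P0 X0.
  by field; rewrite !gt_eqF.
rewrite lerD2l ler_wpM2r ?sqr_ge0//.
by rewrite ler_pdivlMr; [have := @pi2_le10 R; lra|].
Qed.

Lemma ground_state_psi : ground_state constB psiY psiY' psiN.
Proof.
move=> c cb; have w0 := sub1_sqr_gt0 cb; have l4 := psiL_ge4 cb; have u0 := sqr_ge0 c.
have lpos : 0 < psiL c by apply: lt_le_trans l4.
have /andP[k0 k1] := kpsi_bounds.
(* w (k - ln w) <= k + 1 < 50 for w in (0, 1], hence 1 / (w psiL) exceeds kap and
   the correction does not spoil Y' >= 0. *)
have D50 : (1 - c ^+ 2) * psiL c <= 50.
  have h : - ln (1 - c ^+ 2) <= (1 - c ^+ 2)^-1.
    by rewrite -lnV ?posrE//; apply/ltW/ln_sublinear; rewrite invr_gt0.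
  have w1 : (1 - c ^+ 2) * (1 - c ^+ 2)^-1 = 1 by rewrite divff// gt_eqF.
  have w2 : 1 - c ^+ 2 <= 1 by lra.
  rewrite /psiL /ellp; move: (1 - c ^+ 2) w0 h w1 w2 => w w0 h w1 w2.
  have h1 : w * - ln w <= 1 by rewrite -[leRHS]w1 ler_wpM2l// ltW.
  have h2 : w * kpsi <= 1 * kpsi by rewrite ler_wpM2r//; lra.
  lra.
have Y'0 : 0 <= psiY' c.
  rewrite addr_ge0//.
    rewrite subr_ge0 /kap -[leRHS]div1r ler_pdivlMr; last exact: mulr_gt0.
    lra.
  rewrite divr_ge0 ?sqr_ge0// mulr_ge0//; first by rewrite mulr_ge0.
  by rewrite subr_ge0; apply: le_trans l4; lra.
split.
- exact: der_psiY.
- have cw : {for c, continuous (fun u : R => 1 - u ^+ 2)} by cf.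
  have cl : {for c, continuous psiL} by rewrite /psiL /ellp; cf.
  split; rewrite /psiY' /psiN; cf; rewrite ?expf_neq0 ?mulf_neq0 ?expf_neq0 ?gt_eqF//.
- by rewrite /psiN invr_ge0 mulr_ge0 ?sqr_ge0// ltW.
- by rewrite addr_ge0// sqr_ge0.
have := @psi_riccati (1 - c ^+ 2) (psiL c) kap c.
have cE : c ^+ 2 = 1 - (1 - c ^+ 2) by ring.
rewrite !gt_eqF// => /(_ isT isT cE) /= ric; rewrite /psiN ric.
apply: le_trans constB_ge.
have := inv_psiL_le cb; have z0 : 0 <= (psiL c)^-1 by rewrite invr_ge0 ltW.
have q0 : 0 <= kpsi^-1 <= 239 / 1000 by apply: inv_le_bound; lra.
move: q0; rewrite /kap; move: ((psiL c)^-1) (kpsi^-1) (c ^+ 2) u0 w0 z0 => z q u u0 w0 z0 /andP[q0 q1] zq.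
clear -u0 w0 z0 q0 q1 zq.
have z2 : z ^+ 2 <= q ^+ 2 by nra.
have q2 : q ^+ 2 <= 58 / 1000 by nra.
have uz : 0 <= u * z by rewrite mulr_ge0.
have uw : u * (1 - u) <= 1 by nra.
lra.
Qed.

End ground_state_psi.

(** * The Hardy inequalities for phi and psi *)

Section upper_bound.
Context {R : realType}.
Implicit Types (c t s r : R) (x p : R3 R) (f : R3 R -> R) (g : R3 R -> R3 R) (chi : R -> R).
Local Notation sigma := (@surface_measure R).

Lemma phiE t : 0 < t -> phi t = lpi1 - ln t.
Proof.
move=> t0; rewrite /phi ln_div ?posrE ?mulr_gt0 ?pi_gt0 ?expR_gt0//.
by rewrite lnM ?posrE ?pi_gt0 ?expR_gt0// expRK /lpi1 [1 + _]addrC.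
Qed.

Lemma phi0 : phi (0 : R) = 0.
Proof. by rewrite /phi invr0 mulr0 ln0. Qed.

Lemma phi_ge1 t : 0 < t <= pi -> 1 <= phi t.
Proof.
move=> /andP[t0 tpi]; rewrite phiE// /lpi1.
have : ln t <= ln pi by rewrite ler_ln ?posrE ?pi_gt0.
lra.
Qed.

(** rho is increasing on (0, pi], since its derivative is phi - 1 >= 0. *)
Lemma rho_phi_le r t : 0 < r -> r <= t -> t <= pi -> rho phi r <= rho phi t.
Proof.
move=> r0 rt tpi; have t0 : 0 < t by apply: lt_le_trans rt.
have ph1 : 1 <= phi t by rewrite phi_ge1// t0.
move: ph1; rewrite /rho !phiE//.
have h : ln t - ln r <= t / r - 1.
  rewrite -ln_div ?posrE//; have -> : ln (t / r) = ln (1 + (t / r - 1)) by congr ln; ring.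
  by apply: le_ln1Dx; have := divr_gt0 t0 r0; lra.
have {}h : r * (ln t - ln r) <= t - r.
  apply: (@le_trans _ _ (r * (t / r - 1))); first by rewrite ler_wpM2l// ltW.
  by rewrite mulrBr mulr1 mulrCA divff ?gt_eqF// mulr1.
move: (lpi1 : R) (ln t) (ln r) h => X a b h ph1.
have : 0 <= (t - r) * (X - a - 1) by rewrite mulr_ge0//; lra.
lra.
Qed.

(** By monotonicity of rho, t may be replaced by the shorter chord sqrt (2 s), where
    the right-hand side is attained. *)
Lemma rho_phi_pole_weight t s : 0 < s -> 0 < t <= pi -> 2 * s <= t ^+ 2 ->
  4^-1 * (rho phi t ^+ 2)^-1 <= pole_weight kphi s.
Proof.
move=> s0 /andP[t0 tpi] st.
pose r := Num.sqrt (2 * s).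
have s20 : 0 < 2 * s by rewrite mulr_gt0.
have r0 : 0 < r by rewrite sqrtr_gt0.
have rr : r ^+ 2 = 2 * s by rewrite sqr_sqrtr// ltW.
have rt : r <= t by rewrite -(@ler_pXn2r _ 2) ?nnegrE ?(ltW r0) ?(ltW t0)// rr.
have rpi : r <= pi by apply: le_trans tpi.
have rh := rho_phi_le r0 rt tpi.
have rho0 : 0 < rho phi r.
  by rewrite /rho mulr_gt0//; apply: lt_le_trans (phi_ge1 _); rewrite ?r0.
rewrite /pole_weight; have -> : 2 * s * ellp kphi s ^+ 2 = 4 * rho phi r ^+ 2.
  have lr : ln s = 2 * ln r - ln 2.
    have : ln (r ^+ 2) = ln 2 + ln s by rewrite rr lnM ?posrE.
    by rewrite lnXn// mulr2n => e; lra.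
  rewrite /ellp /rho phiE// exprMn rr lr /kphi; ring.
have rhot0 : 0 < rho phi t by apply: lt_le_trans rh.
have sq0 u : 0 < rho phi u -> 0 < 4 * rho phi u ^+ 2.
  by move=> u0; apply: mulr_gt0 => //; exact: exprn_gt0.
rewrite -invfM lef_pV2 ?posrE ?sq0//.
by rewrite ler_pM2l// ler_pXn2r ?nnegrE ?(ltW rho0) ?(ltW rhot0)//.
Qed.

(** The weight of f^2 in Q p f chi. *)
Definition weight chi p x : R := 4^-1 *
  ((rho chi (geodesic x p) ^+ 2)^-1 + (rho chi (pi - geodesic x p) ^+ 2)^-1).

Lemma weight_ge0 chi p x : 0 <= weight chi p x.
Proof. by rewrite /weight mulr_ge0// addr_ge0// invr_ge0 sqr_ge0. Qed.

Lemma le_acos c d : -1 <= c <= 1 -> -1 <= d <= 1 -> c <= d -> acos d <= acos c.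
Proof.
move=> cb db cd; rewrite leNgt; apply/negP => h; move: cd; rewrite leNgt => /negP; apply.
have i e : -1 <= e <= 1 -> acos e \in `[0, pi].
  by move=> eb; rewrite in_itv/= acos_ge0// acos_lepi.
by rewrite -[ltLHS]acosK ?in_itv// -[ltRHS]acosK ?in_itv// ltr_cos// i.
Qed.

(** acos is only specified on [-1, 1]; clamping its argument makes it monotone on
    the whole line, hence measurable. *)
Lemma measurable_geodesic p : sphere p -> measurable_fun sphere (fun x => geodesic x p).
Proof.
move=> pp; pose h t : R := acos (Num.max (-1) (Num.min 1 t)).
have hb t : -1 <= Num.max (-1) (Num.min 1 t) <= (1 : R).
  by rewrite le_max lexx/= ge_max ge_min lexx; apply/andP; split; lra.
have mh : measurable_fun setT h.
  apply: nonincreasing_measurable => // t u tu; apply: le_acos => //.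
  rewrite ge_max !le_max lexx/=; apply/orP; right.
  by rewrite le_min !ge_min lexx tu orbT.
apply: (eq_measurable_fun (fun x => h (dot x p))) => [x /[!inE] Sx|].
  have /andP[d1 d2] := dot_sphere_bound Sx pp.
  by rewrite /h /geodesic min_r// max_r.
by apply: (measurableT_comp mh); apply: measurable_cts; exact: continuous_dotl.
Qed.

Lemma measurable_weight chi p : sphere p -> measurable_fun setT chi ->
  measurable_fun sphere (weight chi p).
Proof.
move=> pp mchi; have mg := measurable_geodesic pp.
have mg' : measurable_fun sphere (fun x => pi - geodesic x p) by exact: measurable_funB.
rewrite /weight /rho; apply: measurable_funM => //.
by apply: measurable_funD; apply: measurable_funV; apply: measurable_funX;
  apply: measurable_funM => //; exact: (measurableT_comp mchi).
Qed.

Lemma measurable_phi : measurable_fun setT (@phi R).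
Proof.
apply: (measurableT_comp (@measurable_ln R)); apply: measurable_funM => //.
exact: measurable_invr.
Qed.

Lemma measurable_psi : measurable_fun setT (@psi R).
Proof.
apply: (measurableT_comp measurable_phi).
by apply: continuous_measurable_fun; exact: continuous_sin.
Qed.

Lemma Q_weight p f chi : sphere p -> measurable_fun setT chi -> measurable_fun sphere f ->
  Q p f chi = (\int[sigma]_(x in sphere) (f x ^+ 2 * weight chi p x)%:E)%E.
Proof.
move=> pp mchi mf; rewrite /Q -ge0_integralZl_EFin//; last 3 first.
- exact: measurable_sphere.
- by move=> x _; rewrite lee_fin addr_ge0// divr_ge0// sqr_ge0.
- apply/measurable_EFinP.
  have mw := measurable_weight pp mchi.
  apply: (eq_measurable_fun (fun x => 4 * (f x ^+ 2 * weight chi p x))) => [x _|].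
    by rewrite /weight; move: ((rho chi (geodesic x p) ^+ 2)^-1)
      ((rho chi (pi - geodesic x p) ^+ 2)^-1) => a b; field.
  by apply: measurable_funM => //; apply: measurable_funM => //; exact: measurable_funX.
apply: eq_integral => x _; rewrite -EFinM; congr EFin.
by rewrite /weight; ring.
Qed.

Lemma geodesic_cos x p : sphere x -> sphere p ->
  cos (geodesic x p) = dot x p /\ 0 <= geodesic x p <= pi.
Proof.
move=> Sx Sp; have cb := dot_sphere_bound Sx Sp.
by rewrite /geodesic acosK ?in_itv// acos_ge0// acos_lepi.
Qed.

Lemma chord_le t : 0 <= t -> 2 * (1 - cos t) <= t ^+ 2.
Proof. by move=> t0; have := cos_ge t0; lra. Qed.

Lemma pole_weight_ge0 s : 0 <= s -> 0 <= pole_weight kphi s.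
Proof. by move=> s0; rewrite /pole_weight invr_ge0 mulr_ge0 ?sqr_ge0// mulr_ge0. Qed.

Lemma rho0 chi : rho chi 0 = 0.
Proof. by rewrite /rho mul0r. Qed.

Lemma weight_phi_int p x : sphere p -> sphere x -> -1 < dot x p < 1 ->
  weight phi p x <= poleN kphi (dot x p).
Proof.
move=> Sp Sx cb; have [ct /andP[t0 tpi]] := geodesic_cos Sx Sp.
move: cb; rewrite /weight -ct; move: (geodesic x p) t0 tpi => t t0 tpi /andP[c0 c1].
have t1 : 0 < t.
  by rewrite lt_neqAle t0 andbT; apply/eqP => e; move: c1; rewrite -e cos0 ltxx.
have t2 : t < pi.
  by rewrite lt_neqAle tpi andbT; apply/eqP => e; move: c0; rewrite e cospi ltxx.
rewrite mulrDr; apply: lerD.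
  apply: rho_phi_pole_weight; [lra|by rewrite t1|exact: chord_le].
apply: rho_phi_pole_weight; [lra|by apply/andP; split; lra|].
have : 2 * (1 - cos (pi - t)) <= (pi - t) ^+ 2 by apply: chord_le; lra.
by rewrite cosB cospi sinpi mul0r addr0 mulN1r opprK.
Qed.

Lemma weight_pole_phi s : 0 < s <= 2 -> 4^-1 * (rho phi pi ^+ 2)^-1 <= pole_weight kphi s.
Proof.
move=> /andP[s0 s2]; apply: rho_phi_pole_weight => //; first by rewrite pi_gt0 lexx.
by have := @pi_ge3 R; nra.
Qed.

Lemma dot_pole c : `|c| = 1 -> c = 1 \/ c = -1.
Proof. by have [_|_] := ger0P c => h; [left|right; lra]. Qed.

(** At a pole the term with distance 0 is 1/0 = 0, and the other one is
    1 / (4 rho(pi)^2), which no pole weight falls below as rho is increasing. *)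
Lemma weight_phi_pole p x t : sphere p -> sphere x -> `|dot x p| = 1 -> 0 <= t < 1 ->
  weight phi p x <= poleN kphi (t * dot x p).
Proof.
move=> Sp Sx /dot_pole c1 /andP[t0 t1]; rewrite /weight /geodesic /poleN.
have key : 4^-1 * (rho phi pi ^+ 2)^-1 <= pole_weight kphi (1 - t) + pole_weight kphi (1 + t).
  rewrite -[leLHS]add0r lerD ?pole_weight_ge0//; first lra.
  by apply: weight_pole_phi; apply/andP; split; lra.
case: c1 => ->; rewrite ?acos1 ?acosN1 ?subr0 ?subrr rho0 expr0n invr0 ?add0r ?addr0.
  by rewrite mulr1.
by rewrite mulrN1 opprK addrC.
Qed.

Lemma weight_psi_int p x : sphere p -> sphere x -> -1 < dot x p < 1 ->
  weight psi p x <= psiN (dot x p).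
Proof.
move=> Sp Sx cb; have [ct /andP[t0 tpi]] := geodesic_cos Sx Sp.
have l4 := psiL_ge4 cb; have w0 := sub1_sqr_gt0 cb.
move: cb l4 w0; rewrite /weight -ct; move: (geodesic x p) t0 tpi => t t0 tpi /andP[c0 c1] l4 w0.
have t1 : 0 < t.
  by rewrite lt_neqAle t0 andbT; apply/eqP => e; move: c1; rewrite -e cos0 ltxx.
have t2 : t < pi.
  by rewrite lt_neqAle tpi andbT; apply/eqP => e; move: c0; rewrite e cospi ltxx.
have s0 : 0 < sin t by apply: sin_gt0_pi; rewrite t1.
have rhoE u : sin u = sin t -> rho psi u = u * psiL (cos t) / 2.
  move=> su; rewrite /rho /psi su phiE// /psiL /ellp /kpsi -sin2cos2 lnXn// mulr2n.
  by field.
have inv_le (s u : R) : 0 < s -> 2 * s <= u ^+ 2 ->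
    4^-1 * ((u * psiL (cos t) / 2) ^+ 2)^-1 <= (2 * s * psiL (cos t) ^+ 2)^-1.
  move=> sp su; have L0 : 0 < psiL (cos t) ^+ 2 by rewrite exprn_gt0//; lra.
  have u0 : 0 < u ^+ 2 by apply: lt_le_trans su; lra.
  rewrite -invfM; have -> : 4 * (u * psiL (cos t) / 2) ^+ 2 = u ^+ 2 * psiL (cos t) ^+ 2 by field.
  have sp2 : 0 < 2 * s by rewrite mulr_gt0.
  have hs : 0 < 2 * s * psiL (cos t) ^+ 2 by exact: mulr_gt0.
  have hu : 0 < u ^+ 2 * psiL (cos t) ^+ 2 by exact: mulr_gt0.
  by rewrite lef_pV2 ?posrE ?hs ?hu// ler_wpM2r// ltW.
have spi : sin (pi - t) = sin t by rewrite sinB cospi sinpi mul0r sub0r mulN1r opprK.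
rewrite (rhoE t erefl) (rhoE _ spi) mulrDr.
have h1 := inv_le (1 - cos t) t _ (chord_le t0).
have h2 : 4^-1 * (((pi - t) * psiL (cos t) / 2) ^+ 2)^-1 <= (2 * (1 + cos t) * psiL (cos t) ^+ 2)^-1.
  apply: inv_le; first lra.
  have : 2 * (1 - cos (pi - t)) <= (pi - t) ^+ 2 by apply: chord_le; lra.
  by rewrite cosB cospi sinpi mul0r addr0 mulN1r opprK.
apply: (le_trans (lerD (h1 _) h2)); first lra.
rewrite /psiN le_eqVlt; apply/orP; left; apply/eqP.
move: (psiL (cos t)) l4 => l l4; move: (cos t) c0 c1 w0 => c c0 c1 w0.
by field; rewrite !gt_eqF//; lra.
Qed.

(** At a pole one distance is 0 and psi vanishes at the other one, pi, because
    1/0 = 0 and ln 0 = 0; so the weight is 0 there. *)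
Lemma weight_psi_pole p x t : sphere p -> sphere x -> `|dot x p| = 1 -> 0 <= t < 1 ->
  weight psi p x <= psiN (t * dot x p).
Proof.
move=> Sp Sx c1 t01; rewrite /weight /geodesic.
have rpi : rho psi pi = 0 :> R by rewrite /rho /psi sinpi phi0 mulr0.
have -> : 4^-1 * ((rho psi (acos (dot x p)) ^+ 2)^-1 +
    (rho psi (pi - acos (dot x p)) ^+ 2)^-1) = 0.
  have [->|->] := dot_pole c1; rewrite ?acos1 ?acosN1 ?subr0 ?subrr.
    by rewrite rho0 rpi expr0n invr0 addr0 mulr0.
  by rewrite rho0 rpi expr0n invr0 addr0 mulr0.
have := dilate_in_oo t01 (dot_sphere_bound Sx Sp).
by move=> /ground_state_psi[].
Qed.

Lemma constA_ge0 : 0 <= constA :> R.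
Proof. by have := @constA_ge R; lra. Qed.

Lemma constB_ge0 : 0 <= constB :> R.
Proof.
have := @constB_ge R; have /andP[k0 _] := @kpsi_bounds R.
have : 0 < (kpsi : R)^-1 by rewrite invr_gt0; lra.
by have := sqr_ge0 (kpsi : R)^-1; lra.
Qed.

Theorem Q_phi_le_T p f g : sphere p -> H1 (f, g) -> (Q p f phi <= T constA f g)%E.
Proof.
move=> Sp Hfg; have [/= mf _ _ _ _] := Hfg.
rewrite (Q_weight Sp measurable_phi mf).
apply: (hardy_H1 Sp constA_ge0 (@ground_state_phi R) Hfg).
- exact: measurable_weight measurable_phi.
- by move=> x _; exact: weight_ge0.
- by move=> x Sx; exact: weight_phi_int.
- by move=> x Sx c1 t t01; exact: weight_phi_pole.
Qed.

Theorem Q_psi_le_T p f g : sphere p -> H1 (f, g) -> (Q p f psi <= T constB f g)%E.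
Proof.
move=> Sp Hfg; have [/= mf _ _ _ _] := Hfg.
rewrite (Q_weight Sp measurable_psi mf).
apply: (hardy_H1 Sp constB_ge0 (@ground_state_psi R) Hfg).
- exact: measurable_weight measurable_psi.
- by move=> x _; exact: weight_ge0.
- by move=> x Sx; exact: weight_psi_int.
- by move=> x Sx c1 t t01; exact: weight_psi_pole.
Qed.

End upper_bound.

(** * Integrals of radial functions *)

Section radial_integrals.
Context {R : realType}.
Implicit Types (c : R) (G E : R -> R) (p x : R3 R).
Local Notation sigma := (@surface_measure R).
Local Notation S h := (\int[sigma]_(x in sphere) (h x)%:E)%E.

(** x.p ranges over [-1, 1] only, and cosp extends it with the same range, so
    continuity on this interval is what integrals of radial functions require. *)
Definition continuous11 G := forall c, -1 <= c <= 1 -> {for c, continuous G}.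

Definition radial_integral p G : R := fine (S (fun x => G (cosp p x))).
Local Notation J := radial_integral.

Context (p : R3 R) (Sp : sphere p).

Lemma continuous_radial G : continuous11 G -> continuous (fun x => G (cosp p x)).
Proof.
move=> cG; apply: cts_comp; first exact: continuous_cosp.
by move=> x; apply: cG; exact: cosp_bound.
Qed.

Lemma radial_integral_fin G : continuous11 G -> S (fun x => G (cosp p x)) = (J p G)%:E.
Proof.
move=> cG; have iG := continuous_integrable_sphere (continuous_radial cG).
by rewrite fineK//; exact: (integrable_fin_num (@measurable_sphere R) iG).
Qed.

Lemma radial_integral_le G1 G2 : continuous11 G1 -> continuous11 G2 ->
  (forall c, -1 <= c <= 1 -> G1 c <= G2 c) -> J p G1 <= J p G2.
Proof.
move=> c1 c2 G12; rewrite -lee_fin -!radial_integral_fin//.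
apply: le_integral.
- exact: measurable_sphere.
- exact: continuous_integrable_sphere (continuous_radial c1).
- exact: continuous_integrable_sphere (continuous_radial c2).
by move=> x _; rewrite lee_fin; apply: G12; exact: cosp_bound.
Qed.

Lemma radial_integralD G1 G2 : continuous11 G1 -> continuous11 G2 ->
  J p (fun c => G1 c + G2 c) = J p G1 + J p G2.
Proof.
move=> c1 c2; have i1 := continuous_integrable_sphere (continuous_radial c1).
have i2 := continuous_integrable_sphere (continuous_radial c2).
have mS := @measurable_sphere R.
rewrite /radial_integral; under eq_integral do rewrite EFinD.
rewrite integralD// fineD//; exact: integrable_fin_num.
Qed.

Lemma radial_integralZ k G : continuous11 G -> J p (fun c => k * G c) = k * J p G.
Proof.
move=> cG; have iG := continuous_integrable_sphere (continuous_radial cG).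
have mS := @measurable_sphere R.
rewrite /radial_integral; under eq_integral do rewrite EFinM.
rewrite integralZl// fineM//; exact: integrable_fin_num.
Qed.

Lemma sphere_area : sigma sphere = (4 * pi)%:E.
Proof.
have mS := @measurable_sphere R.
rewrite -[LHS]mul1e -integral_cst//.
have := @integral_surface R (fun=> 1) (fun x => cvg_cst _); rewrite /cst => ->.
rewrite integral_rect21; last first.
  apply: ctsM; first exact: ctsC.
  by move=> z; apply: continuous_comp; [exact: cvg_fst|exact: continuous_sin].
rewrite (eq_integral (fun=> 2%:E)); last first.
  move=> y _; rewrite /=; under eq_integral do rewrite mul1r.
  rewrite (@continuous_FTC2 _ _ (fun u => - cos u)).
  - by rewrite cospi cos0 opprK -EFinB opprK.
  - exact: pi_gt0.
  - by apply: continuous_subspaceT; exact: continuous_sin.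
  - have dc (u : R) : is_derive u (1 : R) (fun u => - cos u) (sin u).
      by apply: (is_derive_eq (derN (is_derive_cos u))); rewrite opprK.
    have cc : continuous (fun u : R => - cos u).
      by move=> u; apply: cvgN; exact: continuous_cos.
    split; first by move=> u _; case: (dc u).
    + by apply: cvg_at_right_filter; exact: cc.
    + by apply: cvg_at_left_filter; exact: cc.
  - move=> u _; rewrite derive1E.
    have dc : is_derive u (1 : R) (fun u => - cos u) (sin u).
      by apply: (is_derive_eq (derN (is_derive_cos u))); rewrite opprK.
    by case: dc.
rewrite integral_cst//= lebesgue_measure_itv/= lte_fin mulrn_wgt0 ?pi_gt0//.
by rewrite -EFinB -EFinM subr0 -mulr_natr; congr EFin; ring.
Qed.

Lemma radial_integral_cst k : J p (fun=> k) = k * (4 * pi).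
Proof.
rewrite /radial_integral; have mS := @measurable_sphere R.
transitivity (fine (k%:E * sigma sphere)%E); first by rewrite -integral_cst.
by rewrite sphere_area.
Qed.

(** The divergence theorem with a constant function.  Together with linearity,
    monotonicity and the total area it replaces the computation of every radial
    integral below. *)
Lemma radial_divergence (h h' : R -> R) :
  (forall c, -1 <= c <= 1 -> is_derive c (1 : R) h (h' c)) -> continuous11 h' ->
  J p (fun c => h' c * (1 - c ^+ 2) - 2 * c * h c) = 0.
Proof.
move=> dh ch'; rewrite /radial_integral.
have c0 : continuous (fun _ : R3 R => (0 : R3 R)) by move=> x; exact: cvg_cst.
have := divergence_radial Sp (has_gradC 1) c0 dh ch'.
rewrite (eq_integral (fun x => (h' (cosp p x) * (1 - cosp p x ^+ 2) -
  2 * cosp p x * h (cosp p x))%:E)) => [->//|x /[!inE] Sx].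
by rewrite cosp_sphere// /dot/= !mul0r !addr0 mulr0 add0r mul1r.
Qed.

End radial_integrals.

(** * Concentrating test functions *)

Section test_profile.
Context {R : realType}.
Implicit Types (c e : R) (p : R3 R).
Local Notation J := radial_integral.

(** The square of the test function, a truncation of ellp kpsi at scale e. *)
Definition test_log e c := ellp kpsi (1 - c + e).

(** An upper bound for the squared gradient of sqrt (test_log e), and a lower bound,
    up to a constant, for the singular part of the Hardy density. *)
Definition test_energy e c := (1 - c) / (2 * (1 - c + e) ^+ 2 * test_log e c).

Lemma ln_leB1 (u : R) : 0 < u -> ln u <= u - 1.
Proof.
move=> u0; have -> : ln u = ln (1 + (u - 1)) by congr ln; ring.
by apply: le_ln1Dx; lra.
Qed.

Context (e : R) (e01 : 0 < e <= 1).

Lemma test_arg_bounds c : -1 <= c <= 1 -> 0 < 1 - c + e <= 3.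
Proof. by move: e01 => /andP[e0 e1] /andP[c0 c1]; apply/andP; split; lra. Qed.

Lemma test_log_ge2 c : -1 <= c <= 1 -> 2 <= test_log e c.
Proof.
move=> /test_arg_bounds/andP[t0 t3]; rewrite /test_log /ellp.
have : ln (1 - c + e) <= 1 - c + e - 1.
  exact: ln_leB1.
by have /andP[k0 _] := @kpsi_bounds R; lra.
Qed.

Lemma der_test_arg c : is_derive c (1 : R) (fun u => 1 - u + e) (- 1).
Proof.
by apply: (is_derive_eq (derD (derD (derC c 1) (derN (derI c))) (derC c e))); rewrite add0r addr0.
Qed.

Lemma der_test_log c : -1 <= c <= 1 -> is_derive c (1 : R) (test_log e) (1 - c + e)^-1.
Proof.
move=> /test_arg_bounds/andP[t0 _].
apply: (is_derive_eq (der_ellp kpsi (f := fun u => 1 - u + e) t0 (der_test_arg c))).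
by rewrite mulN1r opprK.
Qed.

Lemma continuous11_test_arg : continuous11 (fun c => (1 - c + e)^-1).
Proof. by move=> c /test_arg_bounds/andP[t0 _]; cf; rewrite gt_eqF. Qed.

Lemma continuous11_test_log : continuous11 (test_log e).
Proof. by move=> c /test_arg_bounds/andP[t0 _]; rewrite /test_log /ellp; cf. Qed.

Lemma continuous11_test_energy : continuous11 (test_energy e).
Proof.
move=> c cb; have /andP[t0 _] := test_arg_bounds cb; have l2 := test_log_ge2 cb.
have cl := continuous11_test_log cb; rewrite /test_energy; cf.
have t20 : 0 < (1 - c + e) ^+ 2 by exact: exprn_gt0.
by rewrite !mulf_neq0// ?gt_eqF//; lra.
Qed.

(** The mass of the test function stays bounded as e -> 0: test_log only blows up
    at c = 1, where the term - 2 c h of the divergence identity for h = test_log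
    compensates it. *)
Lemma radial_test_log_le p : sphere p ->
  J p (test_log e) <= (2 + 3 * (kpsi + ln 2)) * (4 * pi).
Proof.
move=> Sp; have cL := continuous11_test_log; have ct := continuous11_test_arg.
have := radial_divergence Sp der_test_log ct.
set E := (fun c => _) => JE.
have cE : continuous11 E by move=> c cb; rewrite /E; have := cL c cb; have := ct c cb => ? ?; cf.
rewrite -[J p (test_log e)]addr0 -JE -radial_integralD// -(radial_integral_cst p).
apply: radial_integral_le => //.
- by move=> c cb; apply: cfD; [exact: cL|exact: cE].
- by move=> c cb; exact: cfC.
move=> c cb; rewrite /E; have l2 := test_log_ge2 cb; have /andP[t0 t3] := test_arg_bounds cb.
move: (cb) e01 => /andP[c0 c1] /andP[e0 e1].
have h1 : (1 - c + e)^-1 * (1 - c ^+ 2) <= 2.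
  by rewrite mulrC ler_pdivrMr//; nra.
have kl : 0 <= kpsi + ln 2 :> R.
  by have := @ln2_ge0 R; have /andP[k0 _] := @kpsi_bounds R; lra.
have [c2|c2] := leP 2^-1 c.
  have : (2 * c - 1) * test_log e c >= 0 by rewrite mulr_ge0//; lra.
  lra.
have h2 : test_log e c <= kpsi + ln 2.
  rewrite /test_log /ellp lerD2l -lnV ?posrE// ler_ln ?posrE ?invr_gt0//.
  by rewrite -[2 in leRHS]invrK lef_pV2 ?posrE ?invr_gt0//; lra.
have : (1 - 2 * c) * test_log e c <= 3 * (kpsi + ln 2).
  by apply: ler_pM => //; lra.
lra.
Qed.

Lemma radial_integral_quadratic p : sphere p -> J p (fun c => c ^+ 2 - c) = 4 * pi / 3.
Proof.
move=> Sp.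
have d1 := radial_divergence Sp (h := fun=> 1) (h' := fun=> 0) (fun c _ => derC c 1)
  (fun c _ => @cfC R c 0).
have d2 := radial_divergence Sp (h := fun c => c) (h' := fun=> 1) (fun c _ => derI c)
  (fun c _ => @cfC R c 1).
move: d1 d2; set E1 := (fun c => _) => d1; set E2 := (fun c => _) => d2.
have c1 : continuous11 E1 by move=> c _; rewrite /E1; cf.
have c2 : continuous11 E2 by move=> c _; rewrite /E2; cf.
have -> : (fun c => c ^+ 2 - c) =
    (fun c => 3^-1 + ((- 3^-1) * E2 c + 2^-1 * E1 c)) :> (R -> R).
  by apply/funext => c; rewrite /E1 /E2; field.
have cz (k : R) G : continuous11 G -> continuous11 (fun c => k * G c).
  by move=> cG c cb; apply: cfM; [exact: cfC|exact: cG].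
rewrite (radial_integralD Sp); last 2 first.
- by move=> c _; exact: cfC.
- by move=> c cb; apply: cfD; [exact: (cz _ _ c2 c cb)|exact: (cz _ _ c1 c cb)].
rewrite (radial_integralD Sp (cz (- 3^-1) _ c2) (cz 2^-1 _ c1)).
by rewrite !radial_integralZ// d1 d2 radial_integral_cst; field.
Qed.

(** ln u <= u - 1 applied twice, to the outer and to the inner logarithm. *)
Lemma ln_test_log_bounds c : -1 <= c <= 1 ->
  0 <= ln (kpsi - ln e) - ln (test_log e c) <= (1 - c) / (e * test_log e c).
Proof.
move=> cb; have /andP[t0 t3] := test_arg_bounds cb; have l2 := test_log_ge2 cb.
move: (cb) e01 => /andP[c0 c1] /andP[e0 e1].
have et : ln e <= ln (1 - c + e) by rewrite ler_ln ?posrE//; lra.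
have kL : test_log e c <= kpsi - ln e by rewrite /test_log /ellp; lra.
have L0 : 0 < test_log e c by lra.
have k0 : 0 < kpsi - ln e by lra.
apply/andP; split; first by rewrite subr_ge0 ler_ln ?posrE.
rewrite -ln_div ?posrE//.
apply: (le_trans (ln_leB1 _)); first exact: divr_gt0.
have -> : (kpsi - ln e) / test_log e c - 1 = (ln (1 - c + e) - ln e) / test_log e c.
  rewrite -[X in _ - X](@divff _ (test_log e c)) ?gt_eqF// -mulrBl; congr (_ / _).
  by rewrite /test_log /ellp; ring.
have -> : (1 - c) / (e * test_log e c) = ((1 - c + e) / e - 1) / test_log e c.
  by field; rewrite !gt_eqF.
rewrite ler_wpM2r ?invr_ge0 ?(ltW L0)//.
by rewrite -ln_div ?posrE//; apply: ln_leB1; exact: divr_gt0.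
Qed.

(** The energy diverges like ln (kpsi - ln e), the value of the integral of
    1 / (s (kpsi - ln s)) over e < s < 1.  Let
    lam = ln (kpsi - ln e) - ln (test_log e c), which grows from 0 at c = 1 to
    about this value.  The divergence identity for h = lam / (1 - c + e) adds to
    8 test_energy a function of integral zero, and the sum is at least lam times
    (1 - c)^2 / (1 - c + e)^2, which is not small on the hemisphere c <= 0.  The
    multiple of c^2 - c is a minorant of it that is negative on the other
    hemisphere but has positive integral. *)
Lemma radial_test_energy_ge p : sphere p ->
  (ln (kpsi - ln e) - ln kpsi) / 8 * (4 * pi / 3) <= 8 * J p (test_energy e).
Proof.
move=> Sp; have cL := continuous11_test_log; have ct := continuous11_test_arg; have cD := continuous11_test_energy.
pose lam c := ln (kpsi - ln e) - ln (test_log e c).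
have L0 c : -1 <= c <= 1 -> 0 < test_log e c by move/test_log_ge2; lra.
have clam : continuous11 lam.
  by move=> c cb; have := L0 c cb; have := cL c cb => ? ?; rewrite /lam; cf.
pose h c := lam c * (1 - c + e)^-1.
pose h' c := (lam c - (test_log e c)^-1) * (1 - c + e)^-1 ^+ 2.
have dh c : -1 <= c <= 1 -> is_derive c (1 : R) h (h' c).
  move=> cb; have /andP[t0 _] := test_arg_bounds cb; have l0 := L0 c cb.
  have t0' : 1 - c + e != 0 by rewrite gt_eqF.
  have dt := derV (f := fun u => 1 - u + e) t0' (der_test_arg c).
  have dl := derD (derC c (ln (kpsi - ln e))) (derN (der_ln l0 (der_test_log cb))).
  apply: (is_derive_eq (derM dl dt)); rewrite /h' /lam.
  by move: (test_log e c) l0 => l l0; field; rewrite t0' gt_eqF.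
have ch' : continuous11 h'.
  move=> c cb; have := clam c cb; have := ct c cb; have := cL c cb => ? ? ?.
  by rewrite /h'; cf; rewrite gt_eqF// L0.
have ch : continuous11 h.
  by move=> c cb; have := clam c cb; have := ct c cb => ? ?; rewrite /h; cf.
have := radial_divergence Sp dh ch'.
set E := (fun c => _) => JE.
have cE : continuous11 E.
  by move=> c cb; have := ch' c cb; have := ch c cb => ? ?; rewrite /E; cf.
have cz (k : R) G : continuous11 G -> continuous11 (fun c => k * G c).
  by move=> cG c cb; apply: cfM; [exact: cfC|exact: cG].
rewrite -radial_integralZ// -[leRHS]addr0 -JE -radial_integralD//; last exact: cz.
have cq : continuous11 (fun c : R => c ^+ 2 - c) by move=> c _; cf.
rewrite -(radial_integral_quadratic Sp) -radial_integralZ//.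
apply: (radial_integral_le Sp); [exact: cz| |].
  by move=> c cb; apply: cfD; [exact: (cz 8 _ cD c cb)|exact: cE].
move=> c cb; have /andP[t0 t3] := test_arg_bounds cb; have l0 := L0 c cb.
have /andP[lam0 lam1] := ln_test_log_bounds cb; rewrite -/(lam c) in lam0 lam1.
move: (cb) e01 => /andP[c0 c1] /andP[e0 e1].
have t20 : 0 < (1 - c + e) ^+ 2 by exact: exprn_gt0.
have -> : 8 * test_energy e c + E c = ((1 - c) * (3 - c) / test_log e c +
    lam c * ((1 - c) ^+ 2 - 2 * e + 2 * (1 - c) * e)) / (1 - c + e) ^+ 2.
  rewrite /test_energy /E /h /h'; move: (lam c) (test_log e c) l0 => la l l0.
  by field; rewrite !gt_eqF.
apply: (@le_trans _ _ (lam c * (1 - c) ^+ 2 / (1 - c + e) ^+ 2)); last first.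
  rewrite ler_wpM2r ?invr_ge0 ?(ltW t20)//.
  have h1 : lam c * e <= (1 - c) / test_log e c.
    apply: le_trans (_ : (1 - c) / (e * test_log e c) * e <= _).
      by rewrite ler_wpM2r// ltW.
    by rewrite le_eqVlt; apply/orP; left; apply/eqP; field; rewrite !gt_eqF.
  have h2 : 0 <= (1 - c) / test_log e c by rewrite divr_ge0 ?(ltW l0)//; lra.
  have h3 : 0 <= lam c * (2 * (1 - c) * e) by rewrite !mulr_ge0//; lra.
  have h4 : 0 <= (1 - c) * ((1 - c) / test_log e c) by rewrite mulr_ge0//; lra.
  move: h1 h2 h3 h4; rewrite -!mulrA; move: ((test_log e c)^-1) => w.
  by move: (lam c) => la; lra.
have LL : 0 <= ln (kpsi - ln e) - ln kpsi.
  have : ln e <= 0 by rewrite -ln1 ler_ln ?posrE.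
  by have /andP[k0 _] := @kpsi_bounds R => ?; rewrite subr_ge0 ler_ln ?posrE; lra.
have [c2|c2] := leP 0 c.
  apply: (@le_trans _ _ 0).
    by rewrite mulr_ge0_le0 ?divr_ge0//; nra.
  by rewrite divr_ge0 ?(ltW t20)// mulr_ge0// sqr_ge0.
have lamL : ln (kpsi - ln e) - ln kpsi <= lam c.
  have /andP[k0 _] := @kpsi_bounds R.
  rewrite /lam lerD2l lerN2 ler_ln ?posrE//; last by lra.
  rewrite /test_log /ellp; have : 0 <= ln (1 - c + e) by apply: ln_ge0; lra.
  lra.
rewrite ler_pdivlMr//.
apply: (@le_trans _ _ ((ln (kpsi - ln e) - ln kpsi) * (1 - c) ^+ 2)); last first.
  by rewrite ler_wpM2r// sqr_ge0.
rewrite -!mulrA ler_wpM2l//.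
have q0 : c ^+ 2 - c <= 2 by nra.
have q1 : (1 - c + e) ^+ 2 <= 4 * (1 - c) ^+ 2 by nra.
have : (c ^+ 2 - c) * (1 - c + e) ^+ 2 <= 2 * (4 * (1 - c) ^+ 2).
  by apply: ler_pM => //; [nra|exact: ltW].
lra.
Qed.

End test_profile.

Section test_function.
Context {R : realType}.
Implicit Types (c e s t : R) (p x : R3 R) (f : R3 R -> R) (g : R3 R -> R3 R) (chi : R -> R).
Local Notation sigma := (@surface_measure R).
Local Notation S h := (\int[sigma]_(x in sphere) (h x)%:E)%E.
Local Notation J := radial_integral.

(** What the lower bound of the Hardy density requires of chi; it holds for phi and
    psi alike, because phi <= psi <= ellp kpsi (1 - cos t) / 2. *)
Definition below_test_log chi := forall t, 0 < t <= pi -> 0 <= cos t ->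
  0 < chi t <= (kpsi - ln (1 - cos t)) / 2.

Lemma below_test_log_phi : below_test_log phi.
Proof.
move=> t tb c0; have /andP[t0 tpi] := tb; apply/andP; split.
  by apply: lt_le_trans (phi_ge1 tb).
have tc := chord_le (ltW t0).
have [s0|s0] := leP (1 - cos t) 0.
  have c1 : cos t = 1 by have := cos_le1 t; lra.
  have /andP[t0' tpi'] : 0 <= t <= pi by rewrite ltW.
  have : t = 0.
    by apply: cos_inj; rewrite ?in_itv/= ?lexx ?pi_ge0 ?t0'// c1 cos0.
  by move=> tE; move: t0; rewrite tE ltxx.
rewrite phiE// /kpsi.
have : ln (1 - cos t) <= 2 * ln t.
  rewrite mulr_natl -lnXn// ler_ln ?posrE ?exprn_gt0//; lra.
lra.
Qed.

Lemma below_test_log_psi : below_test_log psi.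
Proof.
move=> t tb c0; have /andP[t0 tpi] := tb.
have tpi' : t < pi.
  rewrite lt_neqAle tpi andbT; apply/eqP => tE; move: c0; rewrite tE cospi; lra.
have st0 : 0 < sin t by apply: sin_gt0_pi; rewrite t0.
rewrite /psi; apply/andP; split.
  apply: lt_le_trans (phi_ge1 _) => //; rewrite st0/=.
  by apply: (le_trans (sin_le1 t)); have := @pi_ge3 R; lra.
rewrite phiE// /kpsi.
have s2 : sin t ^+ 2 = (1 - cos t) * (1 + cos t) by have := sin2cos2 t; lra.
have ss0 : 0 < sin t ^+ 2 by rewrite exprn_gt0.
have s0 : 0 < 1 - cos t.
  by move: ss0; rewrite s2 pmulr_lgt0//; lra.
have : ln (1 - cos t) <= 2 * ln (sin t).
  rewrite mulr_natl -lnXn// ler_ln ?posrE// s2 ler_peMr//; lra.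
lra.
Qed.

(** s * ellp k s is increasing as long as its derivative ellp k s - 1 is
    nonnegative; it is enough to check this at the right end point. *)
Lemma mul_ellp_le k s t : 0 < s -> s <= t -> 1 <= ellp k t -> s * ellp k s <= t * ellp k t.
Proof.
move=> s0 st; have t0 : 0 < t by apply: lt_le_trans st.
rewrite /ellp => l1; have h : s * (ln t - ln s) <= t - s.
  rewrite -ln_div ?posrE//; apply: (@le_trans _ _ (s * (t / s - 1))).
    by rewrite ler_wpM2l ?ln_leB1 ?divr_gt0// ltW.
  by rewrite mulrBr mulr1 mulrCA divff ?gt_eqF// mulr1.
move: (ln t) (ln s) h l1 => a b h l1.
have : 0 <= (t - s) * (k - a - 1) by rewrite mulr_ge0//; lra.
lra.
Qed.

Lemma test_energy_ge0 e c : 0 < e <= 1 -> -1 <= c <= 1 -> 0 <= test_energy e c.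
Proof.
move=> e01 cb; have := test_log_ge2 e01 cb; have /andP[t0 _] := test_arg_bounds e01 cb.
move: cb => /andP[_ c1] l2; rewrite /test_energy divr_ge0//; first lra.
by rewrite !mulr_ge0 ?sqr_ge0//; lra.
Qed.

(** Near p the geodesic distance d satisfies d cos d <= sin d, whence
    d^2 (1 - s)^2 <= 2 s for s = 1 - cos d.  As s * ellp kpsi s is increasing, it is
    at most (s + e) * test_log e, and the density is at least (1 - s)^2 D, where D
    is the energy.  The error (1 - (1 - s)^2) D is at most 2 s D <= 1/2.  Away from
    p, D itself is at most 1/2. *)
Lemma test_energy_le_weight e chi p x : 0 < e <= 1 -> below_test_log chi ->
  sphere p -> sphere x ->
  test_energy e (dot x p) <= test_log e (dot x p) * weight chi p x + 2^-1.
Proof.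
move=> e01 chik Sp Sx; have cb := dot_sphere_bound Sx Sp.
have l2 := test_log_ge2 e01 cb; have /andP[t0 t3] := test_arg_bounds e01 cb.
have Lw : 0 <= test_log e (dot x p) * weight chi p x.
  by rewrite mulr_ge0 ?weight_ge0//; lra.
have [ct /andP[th0 thpi]] := geodesic_cos Sx Sp.
have D12 : (1 - dot x p) * test_energy e (dot x p) <= 4^-1.
  rewrite /test_energy mulrA ler_pdivrMr ?mulr_gt0 ?exprn_gt0//; last lra.
  have /andP[c0 c1] := cb; have /andP[e0 e1] := e01.
  have h1 : (1 - dot x p) ^+ 2 <= (1 - dot x p + e) ^+ 2 by nra.
  have h2 : 0 <= (1 - dot x p + e) ^+ 2 * (test_log e (dot x p) - 2).
    by rewrite mulr_ge0 ?sqr_ge0//; lra.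
  lra.
have D0 := test_energy_ge0 e01 cb.
have [c0|c0] := ltP (dot x p) 0.
  have : (0 - dot x p) * test_energy e (dot x p) >= 0 by rewrite mulr_ge0//; lra.
  lra.
have [s0|s0] := leP (1 - dot x p) 0.
  have -> : test_energy e (dot x p) = 0.
    by rewrite /test_energy (_ : 1 - dot x p = 0) ?mul0r//; case/andP: cb; lra.
  lra.
suff h : (1 - (1 - dot x p)) ^+ 2 * test_energy e (dot x p) <= test_log e (dot x p) * weight chi p x.
  have : 0 <= (1 - dot x p) ^+ 2 * test_energy e (dot x p) by rewrite mulr_ge0// sqr_ge0.
  lra.
have th1 : 0 < geodesic x p.
  rewrite lt_neqAle th0 andbT; apply/eqP => e0; move: s0.
  by rewrite -ct -e0 cos0 subrr ltxx.
have := chik (geodesic x p); rewrite th1 thpi ct => /(_ isT c0)/andP[ch0 chl].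
have lnb : 0 < kpsi - ln (1 - dot x p) by lra.
set s := 1 - dot x p in s0 chl lnb *; set L := test_log e _ in l2 Lw *.
set l := kpsi - ln s in chl lnb.
have sl : s * l <= (s + e) * L.
  have /andP[e0 e1] := e01.
  by apply: mul_ellp_le => //; [lra|rewrite -/L; have := l2; rewrite /L /test_log /ellp -/s; lra].
have ts : geodesic x p ^+ 2 * (1 - s) ^+ 2 <= 2 * s.
  have h1 : 0 <= geodesic x p * cos (geodesic x p) by rewrite mulr_ge0// ct.
  have h2 := mulcos_le_sin (x := geodesic x p).
  rewrite th0 thpi in h2; have {}h2 := h2 isT.
  have : (geodesic x p * cos (geodesic x p)) ^+ 2 <= sin (geodesic x p) ^+ 2 by nra.
  rewrite exprMn sin2cos2 ct /s opprB addrCA subrr addr0 => /le_trans; apply; nra.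
have r0 : 0 < rho chi (geodesic x p) by rewrite /rho mulr_gt0.
have rl : rho chi (geodesic x p) <= geodesic x p * l / 2.
  by rewrite /rho -mulrA ler_wpM2l// ltW.
have w1 : (geodesic x p ^+ 2 * l ^+ 2)^-1 <= weight chi p x.
  apply: (@le_trans _ _ (4^-1 * (rho chi (geodesic x p) ^+ 2)^-1)); last first.
    by rewrite /weight ler_wpM2l// lerDl invr_ge0 sqr_ge0.
  rewrite -invfM lef_pV2 ?posrE ?mulr_gt0 ?exprn_gt0//; nra.
apply: (@le_trans _ _ (L * (geodesic x p ^+ 2 * l ^+ 2)^-1)); last first.
  by rewrite ler_wpM2l//; lra.
have L0 : 0 < L by lra.
have te0 : 0 < s + e by have /andP[e0 e1] := e01; lra.
rewrite ler_pdivlMr ?mulr_gt0 ?exprn_gt0// /test_energy -/s -/L.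
have -> : (1 - s) ^+ 2 * (s / (2 * (s + e) ^+ 2 * L)) * (geodesic x p ^+ 2 * l ^+ 2) =
  ((geodesic x p ^+ 2 * (1 - s) ^+ 2) * s * l ^+ 2) / (2 * (s + e) ^+ 2 * L).
  by field; rewrite !gt_eqF.
rewrite ler_pdivrMr ?mulr_gt0 ?exprn_gt0//.
apply: (@le_trans _ _ (2 * (s * l) ^+ 2)).
  rewrite exprMn.
  have -> : 2 * (s ^+ 2 * l ^+ 2) = (2 * s) * s * l ^+ 2 by ring.
  by rewrite ler_wpM2r ?sqr_ge0// ler_wpM2r// ltW.
have -> : L * (2 * (s + e) ^+ 2 * L) = 2 * ((s + e) * L) ^+ 2 by ring.
rewrite ler_wpM2l//.
have : 0 <= s * l by rewrite mulr_ge0// ltW.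
nra.
Qed.

Definition test_fun e p x : R := Num.sqrt (test_log e (cosp p x)).

Context (e : R) (e01 : 0 < e <= 1) (p : R3 R) (Sp : sphere p).

Lemma test_log_cosp_gt0 x : 0 < test_log e (cosp p x).
Proof. by have := test_log_ge2 e01 (cosp_bound x Sp); lra. Qed.

Lemma test_fun_sqr x : test_fun e p x ^+ 2 = test_log e (cosp p x).
Proof. by rewrite sqr_sqrtr// ltW// test_log_cosp_gt0. Qed.

Lemma smooth_test_fun : smooth (test_fun e p).
Proof.
have Cdot n : Cn n (fun x : R3 R => dot x x).
  pose e1 : R3 R := (1, 0, 0); pose e2 : R3 R := (0, 1, 0); pose e3 : R3 R := (0, 0, 1).
  apply: (@Cn_ext _ _ (fun x => dot x e1 * dot x e1 + dot x e2 * dot x e2 + dot x e3 * dot x e3)).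
    by move=> x; rewrite /dot /e1 /e2 /e3/=; ring.
  by apply: CnD; [apply: CnD|]; apply: CnM; exact: Cn_dotl.
apply: Cn_smooth => n; apply: Cn_sqrt; first exact: test_log_cosp_gt0.
have Cc : Cn n (cosp p).
  apply: CnM; first by apply: CnM; [exact: CnC|exact: Cn_dotl].
  by apply: Cn_inv; [exact: dotxx1_neq0|apply: CnD; [exact: CnC|exact: Cdot]].
apply: (@Cn_ext _ _ (fun x => kpsi + -1 * ln (1 + -1 * cosp p x + e))).
  by move=> x; rewrite /test_log /ellp !mulN1r.
apply: CnD; first exact: CnC.
apply: CnM; first exact: CnC.
apply: Cn_ln.
  by move=> x; rewrite mulN1r; case/andP: (test_arg_bounds e01 (cosp_bound x Sp)).
apply: CnD; last exact: CnC.
by apply: CnD; [exact: CnC|apply: CnM => //; exact: CnC].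
Qed.

Lemma sphere_gradient_test_fun x : sphere x ->
  dot (sphere_gradient (test_fun e p) x) (sphere_gradient (test_fun e p) x) <= test_energy e (dot x p).
Proof.
move=> Sx; have cb := dot_sphere_bound Sx Sp.
have l2 := test_log_ge2 e01 cb; have /andP[t0 t3] := test_arg_bounds e01 cb.
pose h' c := (2 * Num.sqrt (test_log e c))^-1 * (1 - c + e)^-1.
have gF : has_grad (test_fun e p) (fun x => h' (cosp p x) *: gradient_cosp p x).
  apply: (has_grad_comp (h := fun c => Num.sqrt (test_log e c)) (h' := h') (has_grad_cosp p)) => y.
  have yb := cosp_bound y Sp.
  exact: (der_comp (g := Num.sqrt) (der_test_log e01 yb) (is_derive1_sqrt (test_log_cosp_gt0 y))).
have gE : gradient (test_fun e p) x = h' (dot x p) *: (p - dot x p *: x).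
  rewrite -gradient_cosp_sphere// -{1}(cosp_sphere p Sx).
  rewrite /gradient; have hd v := (has_grad_derive x v gF).2.
  by rewrite !hd; apply: R3_eq; rewrite /dot/=; ring.
have tang : dot (p - dot x p *: x) x = 0.
  by rewrite dotBl dotZl (Sx : dot x x = 1) [dot p x]dotC; ring.
rewrite /sphere_gradient gE dotZl tang mulr0 scale0r subr0.
rewrite dotZl [dot _ (_ *: _)]dotC dotZl dot_tangent// /h' /test_energy mulrA.
have L0 : 0 < test_log e (dot x p) by lra.
have -> : (2 * Num.sqrt (test_log e (dot x p)))^-1 / (1 - dot x p + e) *
    ((2 * Num.sqrt (test_log e (dot x p)))^-1 / (1 - dot x p + e)) =
    (4 * test_log e (dot x p) * (1 - dot x p + e) ^+ 2)^-1.
  rewrite -{3}(sqr_sqrtr (ltW L0)); field.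
  by rewrite !gt_eqF ?sqrtr_gt0.
have -> : (1 - dot x p) / (2 * (1 - dot x p + e) ^+ 2 * test_log e (dot x p)) =
   (4 * test_log e (dot x p) * (1 - dot x p + e) ^+ 2)^-1 * (2 * (1 - dot x p)).
  by field; rewrite !gt_eqF.
have w0 : 0 <= (4 * test_log e (dot x p) * (1 - dot x p + e) ^+ 2)^-1.
  by rewrite invr_ge0 ltW// mulr_gt0 ?exprn_gt0// mulr_gt0.
have c1 : 1 - dot x p ^+ 2 <= 2 * (1 - dot x p) by case/andP: cb => *; nra.
by move: (ler_wpM2l w0 c1); rewrite !mulrA.
Qed.

Lemma H1_smooth f : smooth f -> H1 (f, sphere_gradient f).
Proof.
move=> sf; have cf := continuous_smooth sf; have cg := continuous_sphere_gradient sf.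
have mS := @measurable_sphere R.
have fin (h : R3 R -> R) : continuous h -> (S h < +oo)%E.
  move=> ch; have := integrable_fin_num mS (continuous_integrable_sphere ch).
  by rewrite fin_numE => /andP[_]; rewrite lt_neqAle leey andbT.
split => /=.
- exact: measurable_cts.
- by apply: fin; exact: ctsX.
- by apply: measurable_funTS; exact: continuous_measurable_field.
- by apply: fin; exact: continuous_dot.
exists (fun=> f); split => //.
- rewrite (_ : L2norm2 _ = 0%E); first exact: cvg_cst.
  by rewrite /L2norm2 integral0_eq// => x _; rewrite subrr expr0n.
- rewrite (_ : L2norm2_field _ = 0%E); first exact: cvg_cst.
  by rewrite /L2norm2_field integral0_eq// => x _; rewrite subrr /dot/= !mul0r !addr0.
Qed.

Lemma test_fun_not_ae_zero : ~ ae_zero (test_fun e p).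
Proof.
move=> [N [mN N0 sub]]; have : (sigma sphere <= sigma N)%E.
  apply: le_measure; rewrite ?inE//; first exact: measurable_sphere.
  apply: subset_trans sub => x Sx /= h; have := h Sx; apply/eqP.
  by rewrite gt_eqF// sqrtr_gt0 test_log_cosp_gt0.
by rewrite N0 sphere_area lee_fin leNgt mulr_gt0// pi_gt0.
Qed.

Lemma T_test_fun_le C : 0 <= C -> (T C (test_fun e p) (sphere_gradient (test_fun e p)) <=
  (J p (test_energy e) + C / 4 * ((2 + 3 * (kpsi + ln 2)) * (4 * pi)))%:E)%E.
Proof.
move=> C0; have mS := @measurable_sphere R; rewrite /T EFinD; apply: leeD.
  rewrite -(radial_integral_fin Sp (continuous11_test_energy e01)) /L2norm2_field.
  apply: ge0_le_integral => //.
  - by move=> x _; rewrite lee_fin dot_ge0.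
  - apply/measurable_EFinP; apply: measurable_cts.
    by have cg := continuous_sphere_gradient smooth_test_fun; exact: continuous_dot.
  - by apply/measurable_EFinP; apply: measurable_cts; exact: (continuous_radial Sp (continuous11_test_energy e01)).
  - by move=> x Sx; rewrite lee_fin cosp_sphere//; exact: sphere_gradient_test_fun.
rewrite [X in (_ <= X)%E]EFinM; apply: lee_wpmul2l; first by rewrite lee_fin divr_ge0.
rewrite /L2norm2; under eq_integral do rewrite test_fun_sqr.
by rewrite (radial_integral_fin Sp (continuous11_test_log e01)) lee_fin radial_test_log_le.
Qed.

Lemma le_Q_test_fun chi : below_test_log chi -> measurable_fun setT chi ->
  ((J p (test_energy e))%:E <= Q p (test_fun e p) chi + (2 * pi)%:E)%E.
Proof.
move=> chik mchi; have mS := @measurable_sphere R.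
have mF : measurable_fun sphere (test_fun e p).
  by apply: measurable_cts; exact: continuous_smooth smooth_test_fun.
have mw := measurable_weight Sp mchi.
have mFw : measurable_fun sphere (fun x => test_fun e p x ^+ 2 * weight chi p x).
  by apply: measurable_funM => //; exact: measurable_funX.
rewrite Q_weight//.
have -> : (2 * pi)%:E = S (fun=> 2^-1).
  transitivity (2^-1%:E * sigma sphere)%E; last by rewrite -integral_cst.
  by rewrite sphere_area -EFinM; congr EFin; field.
rewrite -ge0_integralD//; last 2 first.
- by move=> x _; rewrite lee_fin mulr_ge0 ?sqr_ge0 ?weight_ge0.
- exact/measurable_EFinP.
rewrite -(radial_integral_fin Sp (continuous11_test_energy e01)).
apply: ge0_le_integral => //.
- by move=> x _; rewrite lee_fin test_energy_ge0//; exact: cosp_bound.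
- by apply/measurable_EFinP; apply: measurable_cts; exact: (continuous_radial Sp (continuous11_test_energy e01)).
- by apply: emeasurable_funD => //; exact/measurable_EFinP.
- by move=> x Sx; rewrite -EFinD lee_fin test_fun_sqr cosp_sphere//; exact: test_energy_le_weight.
Qed.

End test_function.

(** * Sharpness *)

Section sharpness.
Context {R : realType}.
Implicit Types (f : R3 R -> R) (g : R3 R -> R3 R) (chi : R -> R).

Lemma radial_test_energy_unbounded (p : R3 R) (M : R) : sphere p ->
  exists2 e : R, 0 < e <= 1 & M <= radial_integral p (test_energy e).
Proof.
move=> Sp; pose M' : R := Num.max 0 M; have /andP[k0 _] := @kpsi_bounds R.
have M0 : 0 <= M' by rewrite le_max lexx.
have MM : M <= M' by rewrite le_max lexx orbT.
(* Then ln (kpsi - ln e) - ln kpsi = 16 M' for e = exp (kpsi - E). *)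
pose E := expR (16 * M' + ln kpsi).
have kE : kpsi <= E by rewrite -[leLHS](@lnK R) ?posrE ?ler_expR; lra.
have e01 : 0 < expR (kpsi - E) <= 1 by rewrite expR_gt0 -expR0 ler_expR; lra.
exists (expR (kpsi - E)) => //; apply: (le_trans MM).
have := radial_test_energy_ge e01 Sp; rewrite expRK opprB addrCA subrr addr0 /E expRK.
have h : 0 <= M' * (pi - 3) by rewrite mulr_ge0// subr_ge0 pi_ge3.
lra.
Qed.

Lemma T_ge0 C f g : 0 <= C -> (0 <= T C f g)%E.
Proof.
move=> C0; rewrite /T adde_ge0//.
  by apply: integral_ge0 => x _; rewrite lee_fin dot_ge0.
rewrite mule_ge0 ?lee_fin ?divr_ge0//.
by apply: integral_ge0 => x _; rewrite lee_fin sqr_ge0.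
Qed.

Lemma Q_ge0 p f chi : (0 <= Q p f chi)%E.
Proof.
rewrite /Q mule_ge0//; apply: integral_ge0 => x _.
by rewrite lee_fin addr_ge0// divr_ge0// sqr_ge0.
Qed.

Lemma T_lty C f g : H1 (f, g) -> (T C f g < +oo)%E.
Proof.
move=> [/= _ f2 _ g2 _]; rewrite /T lte_add_pinfty//.
have f0 : (0 <= L2norm2 f)%E by apply: integral_ge0 => x _; rewrite lee_fin sqr_ge0.
have : L2norm2 f \is a fin_num by rewrite ge0_fin_numE.
by move=> /fineK <-; rewrite -EFinM ltry.
Qed.

(** Along the test functions Q exceeds the energy, up to a constant, and T is at
    most the energy plus a constant, while the energy is unbounded; so the quotient
    comes within d of 1 once the energy exceeds, up to these constants, their sum
    divided by d. *)
Lemma sup_ratio_eq1 (p : R3 R) (C : R) chi : sphere p -> 0 <= C ->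
  measurable_fun setT chi -> below_test_log chi ->
  (forall f g, H1 (f, g) -> (Q p f chi <= T C f g)%E) ->
  ereal_sup [set (Q p u.1 chi / T C u.1 u.2)%E |
    u in [set u | H1 u /\ ~ ae_zero u.1]] = 1%E.
Proof.
move=> Sp C0 mchi chik QT; apply/eqP; rewrite eq_le; apply/andP; split.
  apply: ge_ereal_sup => _ [[f g] [/= Hfg _] <-].
  have := QT _ _ Hfg; have := Q_ge0 p f chi; have := T_lty C Hfg.
  have := T_ge0 f g C0.
  case: (T C f g) => [t| |]// t0 _ q0 qt; have [tz|tn0] := eqVneq t 0.
    (* The quotient 0 / 0 is 0. *)
    have -> : Q p f chi = 0%E by apply/eqP; rewrite eq_le q0 andbT; move: qt; rewrite tz.
    by rewrite mul0e.
  have tp : 0 < t by rewrite lt_neqAle eq_sym tn0 -lee_fin.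
  by rewrite inver (negbTE tn0) lee_pdivrMr// mul1e.
apply/lee_addgt0Pr => d d0.
pose b : R := C / 4 * ((2 + 3 * (kpsi + ln 2)) * (4 * pi)).
have b0 : 0 <= b.
  have /andP[k0 _] := @kpsi_bounds R; have l0 := @ln2_ge0 R.
  by rewrite /b !mulr_ge0 ?invr_ge0 ?pi_ge0//; lra.
have [e e01 ae] := radial_test_energy_unbounded ((b + 2 * pi) / d + 2 * pi + 1) Sp.
pose F := test_fun e p; have sF : smooth F := smooth_test_fun e01 Sp.
have HF := H1_smooth sF.
have QF := le_Q_test_fun e01 Sp chik mchi.
have TF := T_test_fun_le e01 Sp C0; rewrite -/b -/F in TF.
have QTF := QT _ _ HF.
apply: (@le_trans _ _ (Q p F chi / T C F (sphere_gradient F) + d%:E)%E); last first.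
  rewrite leeD2r//; apply: ereal_sup_ubound; exists (F, sphere_gradient F) => //=.
  by split => //; exact: test_fun_not_ae_zero.
have := T_ge0 F (sphere_gradient F) C0; have := T_lty C HF; have := Q_ge0 p F chi.
move: TF QTF QF; rewrite -/F.
case: (T C F _) => [t| |]//; case: (Q p F chi) => [q| |]//.
rewrite !lee_fin => TF QTF QF q0 _ t0.
rewrite -/b in TF.
have pp := @pi_gt0 R.
have x0 : 0 <= (b + 2 * pi) / d by rewrite divr_ge0 ?(ltW d0)//; lra.
have bd : b + 2 * pi = d * ((b + 2 * pi) / d) by field; rewrite gt_eqF.
have tp : 0 < t by lra.
rewrite inver gt_eqF// -EFinM -EFinD lee_fin.
have -> : 1 = (t - q) / t + q / t :> R by field; rewrite gt_eqF.
rewrite addrC lerD2l ler_pdivrMr//.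
have : d * ((b + 2 * pi) / d) <= d * t by rewrite ler_wpM2l ?(ltW d0)//; lra.
rewrite -bd; lra.
Qed.

End sharpness.

Theorem theorem2 (R : realType) (p : R3 R) (hp : sphere p) :
  ereal_sup [set (Q p u.1 phi / T constA u.1 u.2)%E |
             u in [set u | H1 u /\ ~ ae_zero u.1]] = 1%E /\
  ereal_sup [set (Q p u.1 psi / T constB u.1 u.2)%E |
             u in [set u | H1 u /\ ~ ae_zero u.1]] = 1%E.
Proof.
split; apply: sup_ratio_eq1 => //.
- exact: constA_ge0.
- exact: measurable_phi.
- exact: below_test_log_phi.
- by move=> f g; exact: Q_phi_le_T.
- exact: constB_ge0.
- exact: measurable_psi.
- exact: below_test_log_psi.
- by move=> f g; exact: Q_psi_le_T.
Qed.
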